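(* Let $(g,\nabla)$ be a statistical structure on $M$ and $\tilde g$ the Sasakian metric on $TM$ determined by $g$ and $\nabla$. Let $\xi\in T_pM$ and let $X,Y\in T_pM$ be unit vectors, assumed orthogonal in the first two formulas. Denote by $k^{\tilde g}(X^a\wedge Y^b)$, $a,b\in\{v,h\}$, the sectional curvature of $\tilde g$ at $\xi$ for the plane spanned by $X^a_\xi,Y^b_\xi$. Then $$k^{\tilde g}(X^v\wedge Y^v)=-k^K(X\wedge Y),$$ $$k^{\tilde g}(X^h\wedge Y^h)=k^g(X\wedge Y)-\tfrac34\|R(X,Y)\xi\|^2,$$ $$k^{\tilde g}(X^v\wedge Y^h)=g([K_X,K_Y]Y,X)+g(\nabla K(Y,X,Y),X)+\|R_1(Y,\xi,X)\|^2.$$ If the statistical structure is conjugate symmetric, then the last formula becomes $$k^{\tilde g}(X^v\wedge Y^h)=g([K_X,K_Y]Y,X)+g(\nabla K(Y,X,Y),X)+\tfrac14\|R(X,\xi)Y\|^2.$$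
   Context: All objects are smooth. A statistical structure on a manifold $M$ is a pair $(g,\nabla)$, where $g$ is a (positive definite) Riemannian metric and $\nabla$ is a torsion-free affine connection such that $(\nabla_Xg)(Y,Z)=(\nabla_Yg)(X,Z)$ for all $X,Y,Z$. $\nabla^g$ is the Levi-Civita connection of $g$; $K(X,Y)=K_XY=\nabla_XY-\nabla^g_XY$; $R$ is the curvature tensor of $\nabla$, with the convention $R(X,Y)Z=\nabla_X\nabla_YZ-\nabla_Y\nabla_XZ-\nabla_{[X,Y]}Z$. Write $\nabla K(Y,X,Z)=(\nabla_YK)(X,Z)$. The structure is conjugate symmetric if $g(R(X,Y)Z,W)=-g(R(X,Y)W,Z)$ for all $X,Y,Z,W$. The $(1,3)$-tensor field $R_1$ is defined by $g(W,R_1(X,Y,Z))=\frac12g(R(W,X)Y,Z)$ for every $W$. $k^g$ is the sectional curvature of $g$, and the sectional $K$-curvature of a plane with orthonormal basis $e_1,e_2$ is $k^K(e_1\wedge e_2)=g([K_{e_1},K_{e_2}]e_2,e_1)$. Let $\pi:TM\to M$ be the tangent bundle. For $\xi,X\in T_pM$: the vertical lift $X^v_\xi\in T_\xi TM$ is the velocity at $t=0$ of the curve $t\mapsto \xi+tX$; the horizontal lift $X^h_\xi\in T_\xi TM$ is the velocity at $t=0$ of the curve $t\mapsto\xi_t$ obtained by $\nabla$-parallel transport of $\xi$ along the $\nabla$-geodesic with initial velocity $X$. One has $T_\xi TM=\{X^v_\xi\}\oplus\{X^h_\xi\}$. The Sasakian metric $\tilde g$ on $TM$ is given by $\tilde g(X^v,Y^v)=g(X,Y)=\tilde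 g(X^h,Y^h)$, $\tilde g(X^v,Y^h)=0$. *)

(* Defs.v *)
From HB Require Import structures.
From mathcomp Require Import all_boot all_order all_algebra.
From mathcomp Require Import all_classical all_reals all_analysis.
Set Implicit Arguments.
Unset Strict Implicit.
Unset Printing Implicit Defensive.
Import Order.TTheory GRing.Theory Num.Theory.
Import numFieldNormedType.Exports.
Local Open Scope classical_set_scope.
Local Open Scope ring_scope.

Fixpoint Ck (R : realType) (V W : normedModType R) (k : nat) (U : set V)
    (f : V -> W) : Prop :=
  if k is k'.+1 then
    (forall x, U x -> differentiable f x) /\
    (forall v, Ck k' U (fun x => 'D_v f x))
  else forall x, U x -> {for x, continuous f}.

Definition smooth (R : realType) (V W : normedModType R) (U : set V)
    (f : V -> W) := forall k, Ck k U f.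

Section CkTheory.
Context {R : realType}.
Implicit Types V W : normedModType R.

Lemma near_eq_differentiable V W (f g : V -> W) (x : V) :
  {near x, f =1 g} -> differentiable f x -> differentiable g x.
Proof.
move=> fg df; have /diff_locallyP[dfc dfx] := df.
have dgx : g \o shift x = cst (g x) + 'd f x +o_ (0 : V) id.
  move: dfx => /eqaddoP dfx; apply/eqaddoP => e e0.
  have fg0 : \forall y \near (0 : V), f (y + x) = g (y + x).
    by move: fg; rewrite (near_shift 0) subr0.
  near=> y.
  have -> : (g \o shift x - (cst (g x) + 'd f x)) y =
            (f \o shift x - (cst (f x) + 'd f x)) y.
    by rewrite !fctE /= (nbhs_singleton fg) (near fg0 y).
  by near: y; exact: dfx.
have dgE : 'd g x = 'd f x :> (V -> W) by exact: diff_unique.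
by apply/diff_locallyP; rewrite dgE.
Unshelve. all: by end_near. Qed.

Lemma Ck_ext V W (U : set V) k (f g : V -> W) : open U ->
  (forall x, U x -> f x = g x) -> Ck k U f -> Ck k U g.
Proof.
move=> oU; elim: k f g => [|k IH] f g fg /=.
  move=> cf x Ux.
  have e : \near x, f x = g x by near=> y; apply: fg; near: y; exact: open_nbhs_nbhs.
  have := cf x Ux; rewrite /prop_for /continuous_at fg// => cfx.
  by apply: cvg_trans cfx; apply: near_eq_cvg; exact: e.
move=> [df Df]; split.
  move=> x Ux; apply: near_eq_differentiable (df x Ux).
  by near=> y; apply: fg; near: y; exact: open_nbhs_nbhs.
move=> v; apply: IH (Df v) => x Ux.
apply: near_eq_derive.
by near=> y; apply: fg; near: y; exact: open_nbhs_nbhs.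
Unshelve. all: by end_near. Qed.

Lemma CkS V W (U : set V) k (f : V -> W) : Ck k.+1 U f -> Ck k U f.
Proof.
elim: k f => [|k IH] f [df Df].
  by move=> x Ux; exact: differentiable_continuous (df x Ux).
by split=> // v; apply: IH; exact: Df.
Qed.

Lemma Ck_cst V W (U : set V) k (c : W) : Ck k U (fun=> c).
Proof.
elim: k c => [|k IH] c /=; first by move=> x _; exact: cvg_cst.
split=> [x _|v]; first exact: differentiable_cst.
rewrite [X in Ck _ _ X](_ : _ = fun=> 0); first exact: IH.
by apply/funext => x; exact: derive_cst.
Qed.

Lemma CkD V W (U : set V) k (f g : V -> W) : open U ->
  Ck k U f -> Ck k U g -> Ck k U (fun x => f x + g x).
Proof.
move=> oU; elim: k f g => [|k IH] f g /=.
  by move=> cf cg x Ux; apply: cvgD; [exact: cf|exact: cg].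
move=> [df Df] [dg Dg]; split=> [x Ux|v].
  by apply: differentiableD; [exact: df|exact: dg].
apply: Ck_ext (IH _ _ (Df v) (Dg v)) => // x Ux.
by rewrite deriveD//; apply: diff_derivable; [exact: df|exact: dg].
Qed.

Lemma Ck_sum V W (U : set V) k (I : Type) (r : seq I) (F : I -> V -> W) :
  open U -> (forall i, Ck k U (F i)) -> Ck k U (fun x => \sum_(i <- r) F i x).
Proof.
move=> oU CF; elim: r => [|i r IH].
  rewrite [X in Ck _ _ X](_ : _ = fun=> 0); first exact: Ck_cst.
  by apply/funext => x; rewrite big_nil.
rewrite [X in Ck _ _ X](_ : _ = fun x => F i x + \sum_(i <- r) F i x).
  exact: CkD.
by apply/funext => x; rewrite big_cons.
Qed.

Lemma Ck_linl V W W' (L : {linear W -> W'}) (U : set V) k (f : V -> W) :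
  continuous L -> open U -> Ck k U f -> Ck k U (fun x => L (f x)).
Proof.
move=> cL oU; elim: k f => [|k IH] f /=.
  by move=> cf x Ux; apply: continuous_comp; [exact: cf|exact: cL].
move=> [df Df]; have dL y : differentiable L y by exact: linear_differentiable.
split=> [x Ux|v]; first by apply: differentiable_comp; [exact: df|].
apply: Ck_ext (IH _ (Df v)) => // x Ux.
rewrite [in RHS]deriveE; last by apply: differentiable_comp; [exact: df|].
rewrite diff_comp//; last exact: df.
by rewrite /= diff_lin// deriveE//; exact: df.
Qed.

Lemma Ck_linr V' V W (L : {linear V' -> V}) (U : set V) k (f : V -> W) :
  continuous L -> open U -> Ck k U f -> Ck k (L @^-1` U) (fun x => f (L x)).
Proof.
move=> cL oU; elim: k f => [|k IH] f /=.
  by move=> cf x Ux; apply: continuous_comp; [exact: cL|exact: cf].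
have dL y : differentiable L y by exact: linear_differentiable.
move=> [df Df]; split=> [x Ux|v].
  by apply: differentiable_comp; [|exact: df].
apply: Ck_ext (IH _ (Df (L v))) => [|x Ux].
  by apply: open_comp => // ? _; exact: cL.
rewrite [in RHS]deriveE; last by apply: differentiable_comp; [|exact: df].
rewrite diff_comp//; last exact: df.
by rewrite /= diff_lin// deriveE//; exact: df.
Qed.

Lemma CkM V (U : set V) k (f g : V -> R) : open U ->
  Ck k U f -> Ck k U g -> Ck k U (fun x => f x * g x).
Proof.
move=> oU; elim: k f g => [|k IH] f g.
  by move=> cf cg x Ux; apply: cvgM; [exact: cf|exact: cg].
move=> Cf Cg; have [df Df] := Cf; have [dg Dg] := Cg; split=> [x Ux|v].
  by apply: differentiableM; [exact: df|exact: dg].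
apply: (@Ck_ext _ _ U _ (fun x => f x * 'D_v g x + g x * 'D_v f x)) => //.
  move=> x Ux; rewrite deriveM//; apply: diff_derivable; [exact: df|exact: dg].
apply: (CkD oU); apply: IH.
- exact: CkS.
- exact: Dg.
- exact: CkS.
- exact: Df.
Qed.
End CkTheory.

Section CkRow.
Context {R : realType}.

Lemma Ck_coord (V : normedModType R) m (U : set V) k (f : V -> 'rV[R]_m) b :
  open U -> Ck k U f -> Ck k U (fun x => f x 0 b).
Proof.
move=> oU Cf; pose g (N : 'rV[R]_m) := N 0 b.
have glin : linear g by move=> r u v; rewrite /g !mxE.
pose glM := GRing.isLinear.Build _ _ _ _ _ glin.
pose gL : {linear _ -> _} := HB.pack g glM.
by apply: (@Ck_linl _ _ _ _ gL) => //; exact: coord_continuous.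
Qed.

Lemma Ck_row (V : normedModType R) m (U : set V) k (f : V -> 'rV[R]_m) :
  open U -> (forall b, Ck k U (fun x => f x 0 b)) -> Ck k U f.
Proof.
move=> oU Cf.
apply: (@Ck_ext _ _ _ U k (fun x => \sum_b f x 0 b *: delta_mx 0 b)) => //.
  by move=> x _; rewrite -row_sum_delta.
apply: Ck_sum => // b.
pose g (r : R) := r *: (delta_mx 0 b : 'rV[R]_m).
have glin : linear g by move=> r u v; rewrite /g scalerDl scalerA.
pose glM := GRing.isLinear.Build _ _ _ _ _ glin.
pose gL : {linear _ -> _} := HB.pack g glM.
by apply: (@Ck_linl _ _ _ _ gL) => //; exact: scalel_continuous.
Qed.

End CkRow.

(* A smooth manifold of dimension n, as a set covered by parametrizations
   par i : dom i -> M, where dom i is open in R^n and crd i is the inverse of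
   par i (the coordinates of the chart; crd i p is meaningless when p is not
   in the chart). The topology is the one induced by the charts, see mopen;
   the separation and countability axioms are stated separately, below. *)
Record manifold (R : realType) (n : nat) := Manifold {
  point :> Type;
  chart : Type;
  dom : chart -> set 'rV[R]_n;
  par : chart -> 'rV[R]_n -> point;
  crd : chart -> point -> 'rV[R]_n;
  dom_open : forall i, open (dom i);
  parK : forall i x, dom i x -> crd i (par i x) = x;
  chart_cover : forall p, exists i, (par i @` dom i) p;
  overlap_open : forall i j,
    open (dom i `&` [set x | (par j @` dom j) (par i x)]);
  transition_smooth : forall i j,
    smooth (dom i `&` [set x | (par j @` dom j) (par i x)]) (crd j \o par i)
}.

Section Manifold.
Context {R : realType} {n : nat} (M : manifold R n).
Implicit Types (i j : chart M) (p q : M) (x u : 'rV[R]_n).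

Definition in_chart i : set M := par i @` dom i.

Definition overlap i j : set 'rV[R]_n := dom i `&` [set x | in_chart j (par i x)].

Definition transition i j : 'rV[R]_n -> 'rV[R]_n := crd j \o par i.

Definition mopen (O : set M) : Prop :=
  forall i, open (dom i `&` [set x | O (par i x)]).

Definition mhausdorff : Prop := forall p q, p <> q ->
  exists O O' : set M, [/\ mopen O, mopen O', O p, O' q & O `&` O' = set0].

Definition msecond_countable : Prop := exists B : nat -> set M,
  (forall k, mopen (B k)) /\
  (forall (O : set M) p, mopen O -> O p -> exists2 k, B k p & B k `<=` O).

(* A tangent vector at [foot] is the family of its coordinates in the charts
   around [foot], related by the derivatives of the transition maps; tcrd i is
   set to 0 when [foot] is not in the chart i, so that equal vectors are equal
   as elements of the type [tangent]. *)
Record tangent := Tangent {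
  foot : M;
  tcrd : chart M -> 'rV[R]_n;
  tcrd_out : forall i, ~ in_chart i foot -> tcrd i = 0;
  tcrd_transition : forall i j, in_chart i foot -> in_chart j foot ->
    tcrd j = 'D_(tcrd i) (transition i j) (crd i foot)
}.

Lemma tangent_eq (X Y : tangent) : foot X = foot Y ->
  (forall i, tcrd X i = tcrd Y i) -> X = Y.
Proof.
case: X Y => [p c co ct] [q d d_out dt] /= pq /funext cd.
by subst; congr Tangent; exact: Prop_irrelevance.
Qed.

Lemma crdK i p : in_chart i p -> par i (crd i p) = p.
Proof. by move=> [x dx <-]; rewrite parK. Qed.

Lemma dom_crd i p : in_chart i p -> dom i (crd i p).
Proof. by move=> [x dx <-]; rewrite parK. Qed.

Lemma overlap_refl i x : dom i x -> overlap i i x.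
Proof. by move=> dx; split => //; exists x. Qed.

Lemma transition_diff i j x : overlap i j x -> differentiable (transition i j) x.
Proof. by move=> oij; have [+ _] := @transition_smooth _ _ M i j 1; apply. Qed.

Lemma transition_refl_derive i x u : dom i x -> 'D_u (transition i i) x = u.
Proof.
move=> dx; rewrite -[RHS](derive_id x u); apply: near_eq_derive.
near=> y; rewrite /transition /= parK//; near: y.
by apply: open_nbhs_nbhs; split=> //; exact: dom_open.
Unshelve. all: by end_near. Qed.

Lemma transition_comp_derive i j k x u : overlap i j x -> overlap i k x ->
  'D_u (transition i k) x =
  'D_('D_u (transition i j) x) (transition j k) (transition i j x).
Proof.
move=> oij oik.
have ojk : overlap j k (transition i j x).
  case: oij oik => dx inj [_ ink]; split; first exact: dom_crd.
  by rewrite /transition /= crdK.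
rewrite (@near_eq_derive _ _ _ _ (transition j k \o transition i j)).
  have dij := transition_diff oij; have djk := transition_diff ojk.
  rewrite deriveE; last exact: differentiable_comp.
  by rewrite diff_comp//= -!deriveE.
near=> y; rewrite /transition /= crdK//.
suff [] : overlap i j y by [].
by near: y; apply: open_nbhs_nbhs; split=> //; exact: overlap_open.
Unshelve. all: by end_near. Qed.

Definition cvec_crd i x u j : 'rV[R]_n :=
  if `[< overlap i j x >] then 'D_u (transition i j) x else 0.

Lemma cvec_crd_out i x u j : ~ in_chart j (par i x) -> cvec_crd i x u j = 0.
Proof. by move=> nij; rewrite /cvec_crd asboolF// => -[]. Qed.

Lemma cvec_crd_transition i x u j k :
  in_chart j (par i x) -> in_chart k (par i x) ->
  cvec_crd i x u k =
  'D_(cvec_crd i x u j) (transition j k) (crd j (par i x)).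
Proof.
move=> pj pk; have [dx|ndx] := pselect (dom i x); rewrite /cvec_crd.
  by rewrite !asboolT//; exact: transition_comp_derive.
by rewrite !asboolF ?derive0// => -[].
Qed.

(* The tangent vector at par i x with coordinates u in the chart i. *)
Definition cvec i x u : tangent :=
  Tangent (@cvec_crd_out i x u) (@cvec_crd_transition i x u).

Lemma tcrd_cvec i x u : dom i x -> tcrd (cvec i x u) i = u.
Proof.
move=> dx /=; rewrite /cvec_crd asboolT ?transition_refl_derive//.
exact: overlap_refl.
Qed.

Lemma cvecK i (X : tangent) : in_chart i (foot X) ->
  cvec i (crd i (foot X)) (tcrd X i) = X.
Proof.
move=> pi; apply: tangent_eq => [|j] /=; first by rewrite crdK.
rewrite /cvec_crd; case: asboolP => [[_ pj]|nij].
  by rewrite -tcrd_transition// -(crdK pi).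
rewrite tcrd_out// => pj; apply: nij; split; first exact: dom_crd.
by rewrite /= crdK.
Qed.

End Manifold.

Section TangentBundle.
Context {R : realType} {n : nat} (M : manifold R n).
Implicit Types (i j : chart M).

Definition tb_dom i : set 'rV[R]_(n + n) := lsubmx @^-1` dom i.

Definition tb_par i (z : 'rV[R]_(n + n)) : tangent M :=
  cvec i (lsubmx z) (rsubmx z).

Definition tb_crd i (X : tangent M) : 'rV[R]_(n + n) :=
  row_mx (crd i (foot X)) (tcrd X i).

Lemma tb_dom_open i : open (tb_dom i).
Proof.
by apply: open_comp; [move=> z _; exact: continuous_lsubmx|exact: dom_open].
Qed.

Lemma tb_parK i z : tb_dom i z -> tb_crd i (tb_par i z) = z.
Proof.
by move=> dz; rewrite /tb_crd /tb_par tcrd_cvec//= parK// hsubmxK.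
Qed.

Lemma tb_in_chart i (X : tangent M) :
  (tb_par i @` tb_dom i) X <-> in_chart i (foot X).
Proof.
split=> [[z dz <-]|iX]; first by exists (lsubmx z).
exists (tb_crd i X); first by rewrite /tb_dom /= row_mxKl; exact: dom_crd.
by rewrite /tb_par row_mxKl row_mxKr cvecK.
Qed.

Lemma tb_chart_cover (X : tangent M) : exists i, (tb_par i @` tb_dom i) X.
Proof. by have [i iX] := chart_cover (foot X); exists i; apply/tb_in_chart. Qed.

Lemma tb_overlapE i j :
  tb_dom i `&` [set z | (tb_par j @` tb_dom j) (tb_par i z)] =
  lsubmx @^-1` overlap i j.
Proof.
apply/seteqP; split=> z /= [dz] hz; split=> //=.
  by move/tb_in_chart : hz.
exact/tb_in_chart.
Qed.

Lemma tb_overlap_open i j :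
  open (tb_dom i `&` [set z | (tb_par j @` tb_dom j) (tb_par i z)]).
Proof.
rewrite tb_overlapE; apply: open_comp; last exact: overlap_open.
by move=> z _; exact: continuous_lsubmx.
Qed.

Lemma tb_transition_smooth i j :
  smooth (tb_dom i `&` [set z | (tb_par j @` tb_dom j) (tb_par i z)])
    (tb_crd j \o tb_par i).
Proof.
rewrite tb_overlapE => k; set U := lsubmx @^-1` _.
have oO : open (overlap i j) by exact: overlap_open.
have oU : open U by apply: open_comp => // z _; exact: continuous_lsubmx.
have Ctau l : Ck l (overlap i j) (transition i j) by exact: transition_smooth.
have cl : continuous (lsubmx : 'rV[R]_(n + n) -> 'rV[R]_n).
  exact: continuous_lsubmx.
apply: Ck_row => // b; have := splitK b; case: (fintype.split b) => {}b <- /=.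
  apply: (@Ck_ext _ _ _ U k (fun z => transition i j (lsubmx z) 0 b)) => //.
    by move=> z _; rewrite row_mxEl.
  by apply: Ck_coord => //; exact: Ck_linr.
apply: (@Ck_ext _ _ _ U k (fun z => \sum_a
    z 0 (rshift n a) * 'D_(delta_mx 0 a) (transition i j) (lsubmx z) 0 b)) => //.
  move=> z Uz; rewrite row_mxEr /= /cvec_crd asboolT//.
  have dt := transition_diff Uz.
  rewrite deriveE// [in RHS](row_sum_delta (rsubmx z)) linear_sum summxE.
  by apply: eq_bigr => a _; rewrite linearZ !mxE deriveE.
apply: Ck_sum => // a; apply: CkM => //.
  apply: Ck_coord => //; elim: k => [|k _] /=; first by move=> x _; exact: cvg_id.
  split=> [x _|v]; first exact: ex_diff.
  rewrite [X in Ck _ _ X](_ : _ = fun=> v); first exact: Ck_cst.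
  by apply/funext => x; exact: derive_id.
apply: Ck_coord => //.
by have [_ /(_ (delta_mx 0 a))] := Ctau k.+1; exact: Ck_linr.
Qed.

(* The tangent bundle; its chart i is the one induced by the chart i of M,
   the coordinates being (crd i (foot X), tcrd X i). *)
Definition tangent_bundle : manifold R (n + n) :=
  Manifold tb_dom_open tb_parK tb_chart_cover tb_overlap_open
    tb_transition_smooth.

End TangentBundle.

Section Structures.
Context {R : realType} {n : nat} (M : manifold R n).

(* g X Y is only meaningful when foot X = foot Y. *)
Record metric := Metric {
  metric_form :> tangent M -> tangent M -> R;
  metric_sym : forall X Y, foot X = foot Y ->
    metric_form X Y = metric_form Y X;
  metric_linear : forall (i : chart M) x v, dom i x ->
    scalar (fun u => metric_form (cvec i x u) (cvec i x v));
  metric_gt0 : forall (i : chart M) x u, dom i x -> u != 0 ->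
    0 < metric_form (cvec i x u) (cvec i x u);
  metric_smooth : forall (i : chart M) u v,
    smooth (dom i) (fun x => metric_form (cvec i x u) (cvec i x v))
}.

(* An affine connection, given in each chart i by its Christoffel symbols:
   D i x u v is the value at x of the covariant derivative in the direction u
   of the field with constant coordinates v. *)
Record connection := Connection {
  christoffel :> chart M -> 'rV[R]_n -> 'rV[R]_n -> 'rV[R]_n -> 'rV[R]_n;
  christoffel_linearl : forall i x v, dom i x ->
    linear (fun u => christoffel i x u v);
  christoffel_linearr : forall i x u, dom i x ->
    linear (fun v => christoffel i x u v);
  christoffel_smooth : forall i u v,
    smooth (dom i) (fun x => christoffel i x u v);
  christoffel_transition : forall i j x u v, overlap i j x ->
    let tau := transition i j in
    'D_(christoffel i x u v) tau x =
    'D_u (fun y => 'D_v tau y) x +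
    christoffel j (tau x) ('D_u tau x) ('D_v tau x)
}.

End Structures.

(* Vector fields over the domain of the chart i are represented by their
   coordinates, that is, by functions from R^n to itself. *)
Section Fields.
Context {R : realType} {n : nat} {M : manifold R n}.
Local Notation field := ('rV[R]_n -> 'rV[R]_n).
Implicit Types (g : metric M) (D Dg : connection M) (i : chart M).
Implicit Types (X Y Z W : field).

Definition bracket X Y : field := fun x => 'D_(X x) Y x - 'D_(Y x) X x.

Definition nabla D i X Y : field := fun x => 'D_(X x) Y x + D i x (X x) (Y x).

Definition torsion D i X Y : field :=
  fun x => nabla D i X Y x - nabla D i Y X x - bracket X Y x.

Definition curvature_field D i X Y Z : field := fun x =>
  nabla D i X (nabla D i Y Z) x - nabla D i Y (nabla D i X Z) x
  - nabla D i (bracket X Y) Z x.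

Definition metric_field g i X Y : 'rV[R]_n -> R :=
  fun x => g (cvec i x (X x)) (cvec i x (Y x)).

(* (nabla_X g)(Y, Z) *)
Definition nabla_metric D g i X Y Z : 'rV[R]_n -> R := fun x =>
  'D_(X x) (metric_field g i Y Z) x
  - metric_field g i (nabla D i X Y) Z x
  - metric_field g i Y (nabla D i X Z) x.

Definition K_field D Dg i X Y : field :=
  fun x => nabla D i X Y x - nabla Dg i X Y x.

(* (nabla_X K)(Y, Z) *)
Definition nablaK_field D Dg i X Y Z : field := fun x =>
  nabla D i X (K_field D Dg i Y Z) x
  - K_field D Dg i (nabla D i X Y) Z x - K_field D Dg i Y (nabla D i X Z) x.

Definition torsion_free D : Prop := forall i X Y,
  smooth (dom i) X -> smooth (dom i) Y ->
  forall x, dom i x -> torsion D i X Y x = 0.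

Definition statistical g D : Prop := torsion_free D /\
  forall i X Y Z,
  smooth (dom i) X -> smooth (dom i) Y -> smooth (dom i) Z ->
  forall x, dom i x ->
  nabla_metric D g i X Y Z x = nabla_metric D g i Y X Z x.

Definition levi_civita g Dg : Prop := torsion_free Dg /\
  forall i X Y Z,
  smooth (dom i) X -> smooth (dom i) Y -> smooth (dom i) Z ->
  forall x, dom i x -> nabla_metric Dg g i X Y Z x = 0.

End Fields.

(* Tensors at a point, evaluated on tangent vectors with the same foot. They
   are computed in a chart i around that foot by extending the vectors to
   fields with constant coordinates; by tensoriality, the result depends
   neither on the extension nor on i. *)
Section Tensors.
Context {R : realType} {n : nat} {M : manifold R n}.
Implicit Types (g : metric M) (D Dg : connection M) (i : chart M).
Implicit Types (X Y Z W : tangent M).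

Definition curvature D i X Y Z : tangent M :=
  let x := crd i (foot X) in
  cvec i x
    (curvature_field D i (cst (tcrd X i)) (cst (tcrd Y i)) (cst (tcrd Z i)) x).

Definition K_tensor D Dg i X Y : tangent M :=
  let x := crd i (foot X) in
  cvec i x (K_field D Dg i (cst (tcrd X i)) (cst (tcrd Y i)) x).

(* nablaK D Dg i Y X Z = (nabla_Y K)(X, Z) *)
Definition nablaK D Dg i Y X Z : tangent M :=
  let x := crd i (foot Y) in
  cvec i x
    (nablaK_field D Dg i (cst (tcrd Y i)) (cst (tcrd X i)) (cst (tcrd Z i)) x).

(* [K_X, K_Y] Z *)
Definition K_bracket D Dg i X Y Z : tangent M :=
  cvec i (crd i (foot X))
    (tcrd (K_tensor D Dg i X (K_tensor D Dg i Y Z)) i -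
     tcrd (K_tensor D Dg i Y (K_tensor D Dg i X Z)) i).

(* The vector R_1(X, Y, Z) such that g(W, R_1(X, Y, Z)) = g(R(W, X)Y, Z) / 2
   for all W; it exists and is unique since g is nondegenerate. *)
Definition R1 g D i X Y Z : tangent M :=
  let x := crd i (foot X) in
  cvec i x (xget 0 [set r | forall W, foot W = foot X ->
    g W (cvec i x r) = 2^-1 * g (curvature D i W X Y) Z]).

Definition conjugate_symmetric g D : Prop := forall i X Y Z W,
  in_chart i (foot X) -> foot Y = foot X -> foot Z = foot X ->
  foot W = foot X ->
  g (curvature D i X Y Z) W = - g (curvature D i X Y W) Z.

(* The sectional curvature of g at the plane spanned by X and Y, where Dg is
   the Levi-Civita connection of g. *)
Definition sectional g Dg i X Y : R :=
  g (curvature Dg i X Y Y) X / (g X X * g Y Y - g X Y ^+ 2).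

(* The sectional K-curvature of the plane with orthonormal basis X, Y. *)
Definition K_sectional g D Dg i X Y : R := g (K_bracket D Dg i X Y Y) X.

End Tensors.

Definition has_velocity (R : realType) (n : nat) (M : manifold R n)
    (c : R -> M) (t : R) (V : tangent M) : Prop :=
  foot V = c t /\
  forall i, in_chart i (c t) ->
    (\forall s \near t, in_chart i (c s)) /\
    is_derive t (1 : R) (fun s => crd i (c s)) (tcrd V i).

Section Lifts.
Context {R : realType} {n : nat} {M : manifold R n}.
Implicit Types (g : metric M) (D : connection M).
Implicit Types (xi X Y : tangent M) (A B : tangent (tangent_bundle M)).

(* The covariant derivative at time t of the vector field c along the curve
   foot \o c, whose velocity at time t is V, vanishes. *)
Definition parallel_at D (c : R -> tangent M) (t : R) (V : tangent M) : Prop :=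
  forall i, in_chart i (foot (c t)) ->
    is_derive t (1 : R) (fun s => tcrd (c s) i)
      (- D i (crd i (foot (c t))) (tcrd V i) (tcrd (c t) i)).

(* A is the velocity at 0 of the curve c t = xi + t X in the fibre of xi. *)
Definition vertical_lift xi X A : Prop :=
  exists c : R -> tangent_bundle M,
    (forall t, foot (c t) = foot xi /\
       forall i, tcrd (c t) i = tcrd xi i + t *: tcrd X i) /\
    has_velocity c 0 A.

(* A is the velocity at 0 of the parallel transport c of xi along a geodesic
   with velocity V and initial velocity V 0 = X. *)
Definition horizontal_lift D xi X A : Prop :=
  exists2 e : R, 0 < e & exists (V : R -> tangent M) (c : R -> tangent_bundle M),
  [/\ forall t, `|t| < e ->
        [/\ foot (c t) = foot (V t),
            has_velocity (fun s => foot (V s)) t (V t),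
            parallel_at D V t (V t) &
            parallel_at D c t (V t)],
      V 0 = X, c 0 = xi & has_velocity c 0 A].

(* gt is the Sasakian metric on the tangent bundle determined by g and D. *)
Definition sasakian g D (gt : metric (tangent_bundle M)) : Prop :=
  forall xi X Y A B, foot X = foot xi -> foot Y = foot xi ->
  [/\ vertical_lift xi X A -> vertical_lift xi Y B -> gt A B = g X Y,
      horizontal_lift D xi X A -> horizontal_lift D xi Y B -> gt A B = g X Y &
      vertical_lift xi X A -> horizontal_lift D xi Y B -> gt A B = 0].

End Lifts.

(* Main.v *)
Require Import Defs.
From HB Require Import structures.
From mathcomp Require Import all_boot all_order all_algebra.
From mathcomp Require Import all_classical all_reals all_analysis.
From mathcomp Require Import ring lra.
Set Implicit Arguments.
Unset Strict Implicit.
Unset Printing Implicit Defensive.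
Import Order.TTheory GRing.Theory Num.Theory.
Import numFieldNormedType.Exports.
Local Open Scope classical_set_scope.
Local Open Scope ring_scope.

(** The whole computation takes place in the given chart, where a point of TM
    is a pair z = (x, xi) and D is given by its Christoffel symbols D(x; u, v).

    The metric of TM in the chart.  A tangent vector a = (a1, a2) of TM at
    (x, xi) is the horizontal lift of a1 plus the vertical lift of
    vert a = a2 + D(x; a1, xi), so that (lemma sasakianE)
      gt(a, b) = g(a1, b1) + g(vert a, vert b).
    The Sasakian condition says this only for vectors that are velocities of
    parallel transports along geodesics, so one must know that every horizontal
    vector is one.  This is an existence theorem for an ordinary differential
    equation, obtained from Picard iteration (picard_lindelof,
    geodesic_transport).

    Curvature without moving frames.  For constant coordinate fields a, b the
    Levi-Civita connection Gamma of a metric G satisfies (lc_curvature)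
      G(R(a,b)b, a) = d_a d_b G(a,b) - d_a d_a G(b,b) / 2 - d_b d_b G(a,a) / 2
                      + |Gamma(a,b)|^2 - G(Gamma(a,a), Gamma(b,b)).
    It is applied both to gt and to g.  At the point of interest the lifts are
    extended by constant coordinate vectors, namely V w = (0, w) and
    H u = (u, - D(x; u, xi)).  The functions vert (H u) vanish at that point, so
    in the second derivatives of gt(H c, H d) only their first derivatives
    survive (ddipHHHH, ddipVVHH).  Along horizontal vectors these are
      P(a,b) = d_(H a) vert (H b),
    and P(a,b) - P(b,a) = R(a,b)xi (dvert_h_curvature).

    The connection of TM.  Koszul's formula gives the horizontal and the
    vertical components of Gamma on these vectors (nabla_vv, nabla_hh,
    nabla_vh):
      Gamma(V a, V b) = H(K(a,b)),
      Gamma(H a, H b) = H(Dg(a,b)) + V(P(a,b) + P(b,a)) / 2,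
      Gamma(V a, H b) = V(Dg(b,a)) - H(R_1(b,xi,a)).
    The tensor K enters because nabla g = - 2 g(K . , . ), and the statistical
    condition makes g(K(u,v), w) totally symmetric (K_cubic).  In particular
    R_1 exists because it is read off the horizontal part of Gamma(V a, H b).

    Substituting, the three curvatures are curvature_vv, curvature_hh and
    curvature_vh.  For the horizontal plane the terms in P add up to - 3/4
    times |P(a,b) - P(b,a)|^2; for the mixed plane the derivatives of Dg
    combine with those of D into the covariant derivative of K.  In the
    conjugate symmetric case the curvature of D has all the symmetries of a
    Riemannian curvature, and exchange of pairs turns R_1(Y,xi,X) into
    R(X,xi)Y / 2 (conjugate_symmetric_pair). *)

(** * Vector-valued calculus on the line *)

Section RowVectors.
Context {R : realType}.

Lemma row_normP m (v : 'rV[R]_m) C : 0 <= C ->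
  `|v| <= C <-> forall j, `|v 0 j| <= C.
Proof.
move=> C0; rewrite [X in X <= _]mx_normrE; split.
  by move=> /bigmax_leP[_ h] j; apply: (h (0, j)).
by move=> h; apply/bigmax_leP; split => // -[i j] _ /=; rewrite ord1.
Qed.

Lemma row_norm_coord m (v : 'rV[R]_m) j : `|v 0 j| <= `|v|.
Proof. by have [+ _] := row_normP v (normr_ge0 v); exact. Qed.

Lemma is_derive_rowP (V : normedModType R) m (f : V -> 'rV[R]_m) (t v : V) df :
  is_derive t v f df <-> forall j, is_derive t v (fun s => f s 0 j) (df 0 j).
Proof.
split=> [[d e] j|h].
  move/derivable_mxP : (d) => /(_ 0 j) dj; apply: DeriveDef => //.
  by rewrite -e derive_mx// mxE.
have d : derivable f t v.
  by apply/derivable_mxP => i j; rewrite ord1; have [] := h j.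
apply: DeriveDef => //; rewrite derive_mx//; apply/rowP => j; rewrite mxE.
by have [_] := h j.
Qed.

(** The norm on row vectors is the maximum of the coordinates, so the scalar
    mean value theorem applies to each coordinate separately, with the same
    bound. *)
Lemma bounded_derive_lipschitz m (f df : R -> 'rV[R]_m) (r C : R) :
  (forall t : R, `|t| < r -> is_derive t (1 : R) f (df t)) ->
  (forall t : R, `|t| < r -> `|df t| <= C) ->
  forall s t : R, `|s| < r -> `|t| < r -> `|f t - f s| <= C * `|t - s|.
Proof.
move=> fdf dfC s t; wlog st : s t / s <= t => [hw sr tr|sr tr].
  have [/hw|/ltW/hw] := leP s t; first exact.
  by rewrite distrC (distrC t); exact.
have [->|sNt] := eqVneq s t; first by rewrite !subrr !normr0 mulr0.
have C0 : 0 <= C by apply: le_trans (dfC _ sr).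
have st' : s < t by rewrite lt_neqAle sNt.
apply/row_normP => [|j]; first by rewrite mulr_ge0.
have seg u : s <= u -> u <= t -> `|u| < r.
  move=> su ut; rewrite ltr_norml (lt_le_trans _ su) ?(le_lt_trans ut)//.
    exact: le_lt_trans (ler_norm _) tr.
  by rewrite ltrNl; apply: le_lt_trans sr; rewrite -normrN ler_norm.
have dj u : s <= u -> u <= t ->
    is_derive u (1 : R) (fun s => f s 0 j) (df u 0 j).
  by move=> su ut; move: j; apply/is_derive_rowP; exact: fdf (seg _ su ut).
have [u||u] := @MVT _ (fun s => f s 0 j) (fun u => df u 0 j) _ _ st'.
- by rewrite in_itv /= => /andP[/ltW su /ltW ut]; exact: dj.
- apply: derivable_within_continuous => u; rewrite in_itv /= => /andP[su ut].
  by have [] := dj _ su ut.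
rewrite in_itv /= => /andP[/ltW su /ltW ut]; rewrite !mxE => ->.
rewrite normrM ler_wpM2r//.
exact: le_trans (row_norm_coord _ _) (dfC _ (seg _ su ut)).
Qed.

(** The integrals start at -3 because the fundamental theorem of calculus
    gives a derivative only in the interior of the interval of integration. *)
Lemma continuous_primitive m (h : R -> 'rV[R]_m) : continuous h ->
  exists P : R -> 'rV[R]_m, P 0 = 0 /\
    forall t : R, `|t| < 2 -> is_derive t (1 : R) P (h t).
Proof.
move=> ch.
pose F j (x : R) : R := \int[lebesgue_measure]_(t in [set` `[-3, x]]) (h t 0 j).
have cj j : continuous (fun t => h t 0 j).
  move=> t; apply: (@continuous_comp _ _ _ h (fun v => v 0 j)); first exact: ch.
  exact: coord_continuous.
exists (fun t => \row_j (F j t - F j 0)); split.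
  by apply/rowP => j; rewrite !mxE subrr.
move=> t; rewrite ltr_norml => /andP[t2 t3]; apply/is_derive_rowP => j.
have [dF eF] : derivable (F j) t 1 /\ derive1 (F j) t = h t 0 j.
  apply: (@continuous_FTC1_closed _ (fun t => h t 0 j) (-3) t 3).
  - by apply: lt_trans t3 _; rewrite ltr_nat.
  - apply: continuous_compact_integrable; first exact: segment_compact.
    exact: continuous_subspaceT.
  - by apply: lt_trans t2; rewrite ltrN2 ltr_nat.
  - exact: cj.
rewrite [X in is_derive _ _ X _](_ : _ = F j \- cst (F j 0)); last first.
  by apply/funext => s; rewrite mxE.
rewrite -[h t 0 j]subr0; apply: is_deriveB.
by apply: (DeriveDef dF); rewrite -derive1E.
Qed.

End RowVectors.

(** * Picard iteration for a contracting vector field *)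

Section Picard.
Context {R : realType}.

Lemma cvg_geometric_error (c : R) : (fun k => c * 2^-1 ^+ k) @ \oo --> 0.
Proof.
by apply: cvg_geometric; rewrite ger0_norm ?invr_ge0// invf_lt1// ltr1n.
Qed.

(** This is how inequalities between Picard iterates pass to the limit. *)
Lemma le_geometric_error (a b c : R) :
  (forall k, a <= b + c * 2^-1 ^+ k) -> a <= b.
Proof.
move=> h.
have : (fun k => b + c * 2^-1 ^+ k) @ \oo --> b + 0.
  by apply: cvgD; [exact: cvg_cst|exact: cvg_geometric_error].
by rewrite addr0 => /cvgr_to_ge; apply; exact: nearW.
Qed.

Lemma geometric_cauchy m (u : nat -> 'rV[R]_m) (C : R) :
  (forall k, `|u k.+1 - u k| <= C * 2^-1 ^+ k) ->
  exists l, forall k, `|l - u k| <= 2 * C * 2^-1 ^+ k.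
Proof.
move=> uC.
have C0 : 0 <= C.
  by have := le_trans (normr_ge0 _) (uC 0); rewrite expr0 mulr1.
have tail k j : `|u (k + j)%N - u k| <= 2 * C * 2^-1 ^+ k.
  apply: (@le_trans _ _ (2 * C * (2^-1 ^+ k - 2^-1 ^+ (k + j)))); last first.
    by rewrite ler_wpM2l ?mulr_ge0// lerBlDr lerDl exprn_ge0// invr_ge0.
  elim: j => [|j IH]; first by rewrite addn0 !subrr normr0 mulr0.
  rewrite addnS -(subrKA (u (k + j)%N)); apply: le_trans (ler_normD _ _) _.
  apply: le_trans (lerD (uC _) IH) _.
  by rewrite exprS; lra.
have : cvg (u @ \oo).
  apply/cauchy_cvgP/cauchy_exP => e e0.
  have /cvgrPdist_lt /(_ _ e0) [k _ ke] := cvg_geometric_error (2 * C).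
  exists (u k); exists k => // j /= kj; rewrite -ball_normE /= distrC.
  rewrite -(subnKC kj); apply: le_lt_trans (tail _ _) _.
  have := ke k (leqnn k); rewrite /= sub0r normrN; apply: le_lt_trans.
  exact: ler_norm.
move=> /cvg_ex[l ul]; exists l => k.
have : (fun j => `|u (k + j)%N - u k|) @ \oo --> `|l - u k|.
  apply: cvg_norm; apply: cvgB; last exact: cvg_cst.
  rewrite (_ : (fun j => u (k + j)%N) = [sequence u (j + k)%N]_j).
    by rewrite cvg_shiftn.
  by apply/funext => j; rewrite addnC.
by move=> /cvgr_to_le; apply; exact: nearW.
Qed.

(** The nearest-point retraction of the line onto [a, b]; it makes local
    hypotheses global without increasing Lipschitz constants. *)
Definition clamp (a b t : R) : R := Num.max a (Num.min b t).

Lemma dist_clamp (a b s t : R) : `|clamp a b s - clamp a b t| <= `|s - t|.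
Proof.
have : s - t <= `|s - t| by exact: ler_norm.
have : t - s <= `|s - t| by rewrite distrC; exact: ler_norm.
rewrite /clamp ler_norml; case: (leP b s); case: (leP b t) => ? ?.
- by case: (leP a b); lra.
- by case: (leP a b); case: (leP a t); lra.
- by case: (leP a s); case: (leP a b); lra.
- by case: (leP a s); case: (leP a t); lra.
Qed.

Lemma clamp_itv (a b t : R) : a <= b -> a <= clamp a b t <= b.
Proof. by move=> ab; rewrite /clamp le_max lexx ge_max ab ge_min lexx. Qed.

Lemma clamp_id (a b t : R) : a <= t <= b -> clamp a b t = t.
Proof. by move=> /andP[a1 b1]; rewrite /clamp min_r// max_r. Qed.

Lemma lipschitz_continuous (V W : normedModType R) (f : V -> W) (C : R) :
  (forall x y, `|f x - f y| <= C * `|x - y|) -> continuous f.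
Proof.
move=> fC x; have C1 : 0 < Num.max C 1 by rewrite lt_max ltr01 orbT.
apply/cvgrPdist_le => e e0; near=> y.
apply: (le_trans (fC x y)); apply: (@le_trans _ _ (Num.max C 1 * `|x - y|)).
  by rewrite ler_wpM2r// le_max lexx.
rewrite mulrC -ler_pdivlMr//; near: y.
by apply: cvgr_dist_le; [exact: cvg_id|exact: divr_gt0].
Unshelve. all: by end_near. Qed.

(** Picard iteration on the time interval [-1, 1]: a primitive over that
    interval changes by at most the change of the integrand, so the Lipschitz
    constant 1/2 of F makes consecutive iterates approach each other
    geometrically.  The iterates are made defined and Lipschitz on the whole
    line by clamping time to [-1, 1]. *)
Lemma picard_contraction m (F : 'rV[R]_m -> 'rV[R]_m) (y0 : 'rV[R]_m) (B : R) :
  (forall u, `|F u| <= B) ->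
  (forall u v, `|F u - F v| <= 2^-1 * `|u - v|) ->
  exists y : R -> 'rV[R]_m, [/\ y 0 = y0,
    forall s t, `|y s - y t| <= B * `|s - t| &
    forall t : R, `|t| < 1 -> is_derive t (1 : R) y (F (y t))].
Proof.
move=> FB FL.
have cF : continuous F by exact: lipschitz_continuous FL.
have B0 : 0 <= B by exact: le_trans (FB 0).
have /choice[P PP] (h : R -> 'rV[R]_m) : exists P : R -> 'rV[R]_m,
    continuous h -> P 0 = 0 /\
    forall t : R, `|t| < 2 -> is_derive t (1 : R) P (h t).
  have [/continuous_primitive[P ?]|] := pselect (continuous h).
    by exists P.
  by exists h.
pose tau : R -> R := clamp (-1) 1.
have tau1 t : `|tau t| <= 1.
  by rewrite ler_norml clamp_itv// (le_trans _ ler01)// lerN10.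
have tau2 t : `|tau t| < 2 by rewrite (le_lt_trans (tau1 t))// ltr1n.
have tau_id t : `|t| <= 1 -> tau t = t.
  by rewrite ler_norml => h; rewrite /tau clamp_id.
have tau0 : tau 0 = 0 by rewrite tau_id// normr0 ler01.
have PB h : continuous h -> (forall t, `|h t| <= B) ->
    forall s t, `|P h (tau s) - P h (tau t)| <= B * `|s - t|.
  move=> ch hB s t; have [_ dP] := PP _ ch.
  have dB u : `|u| < 2 -> `|h u| <= B by [].
  apply: (le_trans (bounded_derive_lipschitz dP dB (tau2 t) (tau2 s))).
  by rewrite ler_wpM2l// dist_clamp.
have PC h k C : continuous h -> continuous k -> (forall t, `|h t - k t| <= C) ->
    forall t, `|P h (tau t) - P k (tau t)| <= C.
  move=> ch ck hkC t; have [Ph0 dPh] := PP _ ch; have [Pk0 dPk] := PP _ ck.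
  have dP u : `|u| < 2 -> is_derive u (1 : R) (P h \- P k) (h u - k u).
    by move=> u2; apply: is_deriveB; [exact: dPh|exact: dPk].
  have dC u : `|u| < 2 -> `|h u - k u| <= C by [].
  have := bounded_derive_lipschitz dP dC (tau2 0) (tau2 t).
  rewrite /= tau0 Ph0 Pk0 !subr0 => /le_trans; apply.
  by rewrite ler_piMr// (le_trans _ (hkC 0)).
pose x := fix x k : R -> 'rV[R]_m :=
  if k is k'.+1 then fun t => y0 + P (F \o x k') (tau t) else cst y0.
have cFx k : continuous (x k) -> continuous (F \o x k).
  by move=> cx t; apply: continuous_comp; [exact: cx|exact: cF].
have xL k s t : `|x k s - x k t| <= B * `|s - t|.
  elim: k s t => [|k IH] s t; first by rewrite /= subrr normr0 mulr_ge0.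
  rewrite /= [y0 + _]addrC addrKA PB// => [|u /=]; last exact: FB.
  by apply: cFx; exact: lipschitz_continuous IH.
have cx k : continuous (x k) by exact: lipschitz_continuous (xL k).
have xd t k : `|x k.+1 t - x k t| <= B * 2^-1 ^+ k.
  elim: k t => [|k IH] t.
    rewrite /= addrC addKr expr0 mulr1.
    have [P0 dP] := PP _ (cFx _ (cx 0%N)).
    have dB u : `|u| < 2 -> `|F (x 0%N u)| <= B by [].
    have := bounded_derive_lipschitz dP dB (tau2 0) (tau2 t).
    rewrite tau0 P0 !subr0 => /le_trans; apply.
    by rewrite ler_piMr.
  rewrite [x k.+2]/= [in X in _ - X]/= [y0 + _]addrC addrKA.
  apply: (PC _ _ _ (cFx _ (cx k.+1)) (cFx _ (cx k))).
  move=> u /=; apply: (le_trans (FL _ _)).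
  by rewrite exprS mulrCA ler_wpM2l ?invr_ge0//; exact: IH.
have /choice[X Xx] t := geometric_cauchy (xd t).
have XL s t : `|X s - X t| <= B * `|s - t|.
  apply: (@le_geometric_error _ _ (4 * B)) => k.
  have -> : X s - X t = (X s - x k s) + (x k s - x k t) - (X t - x k t).
    by rewrite subrKA opprB subrKA.
  apply: (le_trans (ler_normB _ _)).
  have := ler_normD (X s - x k s) (x k s - x k t).
  by have := Xx s k; have := Xx t k; have := xL k s t; lra.
have cX : continuous X by exact: lipschitz_continuous XL.
have cFX : continuous (F \o X).
  by move=> t; apply: continuous_comp; [exact: cX|exact: cF].
have XE t : X t = y0 + P (F \o X) (tau t).
  apply/eqP; rewrite -subr_eq0 -normr_le0.
  apply: (@le_geometric_error _ _ (2 * B)) => k; rewrite add0r.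
  rewrite -(subrKA (x k.+1 t)); apply: (le_trans (ler_normD _ _)).
  have h1 := Xx t k.+1.
  have h2 : `|x k.+1 t - (y0 + P (F \o X) (tau t))| <= B * 2^-1 ^+ k.
    rewrite [x k.+1 t]/= [X in X - _]addrC addrKA.
    apply: (PC _ _ _ (cFx _ (cx k)) cFX) => u /=.
    apply: (le_trans (FL _ _)); rewrite distrC; have := Xx u k; lra.
  by apply: (le_trans (lerD h1 h2)); rewrite exprS; lra.
have [P0 dP] := PP _ cFX.
exists X; split=> [||t t1] //; first by rewrite XE tau0 P0 addr0.
rewrite -[F _]add0r.
have t2 : `|t| < 2 by rewrite (lt_trans t1)// ltr1n.
have := is_deriveD (is_derive_cst y0 t (1 : R)) (dP t t2).
apply: near_eq_is_derive; near=> s; rewrite XE tau_id//; apply: ltW.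
by near: s; apply: cvgr_norm_lt t1; exact: cvg_id.
Unshelve. all: by end_near. Qed.

End Picard.

(** * Local existence of integral curves *)

Section PicardLindelof.
Context {R : realType}.

(** Bounds on the partial derivatives thereby bound all directional
    derivatives. *)
Lemma derive_sum_delta m (W : normedModType R) (f : 'rV[R]_m -> W) x v :
  differentiable f x ->
  'D_v f x = \sum_a v 0 a *: 'D_(delta_mx 0 a) f x.
Proof.
move=> df; rewrite deriveE// [in LHS](row_sum_delta v) linear_sum.
by apply: eq_bigr => a _; rewrite linearZ /= deriveE.
Qed.

Lemma is_derive_along (V W : normedModType R) (f : V -> W) (c : R -> V)
    (t : R) (c' : V) :
  differentiable f (c t) -> is_derive t (1 : R) c c' ->
  is_derive t (1 : R) (fun s => f (c s)) ('D_c' f (c t)).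
Proof.
move=> df [dc <-]; have /derivable1_diffP dc' := dc.
have dfc : differentiable (f \o c) t by exact: differentiable_comp.
apply: DeriveDef; first exact: diff_derivable.
by rewrite !deriveE// diff_comp.
Qed.

(** Near y0 the partial derivatives are bounded by continuity; the mean value
    theorem along segments turns this into a Lipschitz bound. *)
Lemma C1_locally_lipschitz m p (U : set 'rV[R]_m) (F : 'rV[R]_m -> 'rV[R]_p)
    y0 : open U -> Ck 1 U F -> U y0 ->
  exists r L B : R, [/\ 0 < r, 0 <= L, 0 <= B,
    forall u, `|u - y0| <= r -> U u /\ `|F u| <= B &
    forall u v, `|u - y0| <= r -> `|v - y0| <= r ->
      `|F u - F v| <= L * `|u - v|].
Proof.
move=> oU [dF DF] Uy0.
have near_le (G : 'rV[R]_m -> 'rV[R]_p) : {for y0, continuous G} ->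
    \forall y \near y0, `|G y| <= `|G y0| + 1.
  by move=> cG; apply: (cvgr_norm_le _ cG); rewrite ltrDl.
pose C := \sum_(a < m) (`|'D_(delta_mx 0 a) F y0| + 1).
have nC : \forall y \near y0, [/\ U y, `|F y| <= `|F y0| + 1 &
    forall a : 'I_m, `|'D_(delta_mx 0 a) F y| <= `|'D_(delta_mx 0 a) F y0| + 1].
  have n1 : \forall y \near y0, U y by exact: open_nbhs_nbhs.
  have n2 := near_le _ (differentiable_continuous (dF _ Uy0)).
  have n3 : \forall y \near y0, forall a : 'I_m,
      `|'D_(delta_mx 0 a) F y| <= `|'D_(delta_mx 0 a) F y0| + 1.
    apply: (@filter_forall _ _ (fun a => [set y |
      `|'D_(delta_mx 0 a) F y| <= `|'D_(delta_mx 0 a) F y0| + 1]) (nbhs y0) _) => a.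
    exact: near_le (DF _ _ Uy0).
  by near=> y; split; near: y.
have /nbhs_ballP[e /= e0 eC] := nC.
have {}eC u : `|u - y0| < e -> [/\ U u, `|F u| <= `|F y0| + 1 &
    forall a : 'I_m, `|'D_(delta_mx 0 a) F u| <= `|'D_(delta_mx 0 a) F y0| + 1].
  by move=> ue; apply: eC; rewrite -ball_normE /= distrC.
exists (e / 6), C, (`|F y0| + 1).
(* With u and v within e / 6 of y0, the point v + t (u - v) stays within
   5 e / 6 of y0 for |t| < 2, an open interval around [0, 1]. *)
have e6 u : `|u - y0| <= e / 6 -> `|u - y0| < e by lra.
have C0 : 0 <= C by apply: sumr_ge0 => a _; rewrite addr_ge0.
split=> //; first by rewrite divr_gt0// ltr0n.
  by move=> u /e6 /eC[].
move=> u v ur vr; pose c t := v + t *: (u - v).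
have ct t : `|t| < 2 -> `|c t - y0| < e.
  move=> t2; rewrite /c addrAC; apply: (le_lt_trans (ler_normD _ _)).
  rewrite normrZ; have : `|u - v| <= e / 6 + e / 6.
    rewrite -(subrKA y0); apply: (le_trans (ler_normD _ _)).
    by rewrite (distrC y0) lerD.
  have := ler_pM (normr_ge0 t) (normr_ge0 (u - v)) (ltW t2).
  by move=> /[apply]; lra.
have dc t : is_derive t (1 : R) c (u - v).
  rewrite -[u - v]add0r; apply: is_deriveD.
  have dl : is_diff t ( *:%R^~ (u - v)) ( *:%R^~ (u - v)).
    exact: is_diff_scalel.
  apply: DeriveDef; first exact: diff_derivable.
  by rewrite deriveE// diff_val scale1r.
have d t : `|t| < 2 ->
    is_derive t (1 : R) (fun s => F (c s)) ('D_(u - v) F (c t)).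
  by move=> /ct /eC[Uc _ _]; apply: is_derive_along => //; exact: dF.
have dC t : `|t| < 2 -> `|'D_(u - v) F (c t)| <= C * `|u - v|.
  move=> /ct /eC[Uc _ DC]; rewrite derive_sum_delta; last exact: dF.
  apply: (le_trans (ler_norm_sum _ _ _)); rewrite mulr_suml.
  apply: ler_sum => a _; rewrite normrZ mulrC ler_pM//.
  exact: row_norm_coord.
have := bounded_derive_lipschitz d dC.
move=> /(_ 0 1); rewrite normr0 normr1 ltr0n ltr1n => /(_ isT isT).
by rewrite /c scale0r scale1r addr0 subrKC subr0 normr1 mulr1.
Unshelve. all: by end_near. Qed.

(** F is precomposed with the retraction onto a small box around y0, on which
    it is bounded and Lipschitz, and multiplied by a small constant e so that
    the contraction theorem applies and the solution stays in the box.
    Slowing time down by e recovers F itself. *)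
Lemma picard_lindelof m (U : set 'rV[R]_m) (F : 'rV[R]_m -> 'rV[R]_m) y0 :
  open U -> Ck 1 U F -> U y0 ->
  exists2 e : R, 0 < e & exists2 y : R -> 'rV[R]_m, y 0 = y0 &
    forall t : R, `|t| < e -> U (y t) /\ is_derive t (1 : R) y (F (y t)).
Proof.
move=> oU CF Uy0.
have [r [L [B [r0 L0 B0 UB FL]]]] := C1_locally_lipschitz oU CF Uy0.
pose rho (u : 'rV[R]_m) := \row_j clamp (y0 0 j - r) (y0 0 j + r) (u 0 j).
have rho_box u : `|rho u - y0| <= r.
  apply/(row_normP _ (ltW r0)) => j; rewrite !mxE ler_distl clamp_itv//.
  by rewrite lerD2l ge0_cp// ltW.
have rhoL u v : `|rho u - rho v| <= `|u - v|.
  apply/(row_normP _ (normr_ge0 _)) => j; rewrite !mxE.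
  apply: (le_trans (dist_clamp _ _ _ _)).
  by have := row_norm_coord (u - v) j; rewrite !mxE.
have rho_id u : `|u - y0| <= r -> rho u = u.
  move=> /(row_normP _ (ltW r0)) ur; apply/rowP => j; rewrite mxE clamp_id//.
  by rewrite -ler_distl; have := ur j; rewrite !mxE.
have [e [e0 eL eB]] : exists e, [/\ 0 < e, e * L <= 2^-1 & e * B <= r].
  pose s := Num.max (2 * L) (B / r) + 1.
  have s0 : 0 < s by rewrite ltr_wpDl// le_max mulr_ge0.
  have s1 : 2 * L <= s by rewrite ler_wpDr// le_max lexx.
  have s2 : B / r <= s by rewrite ler_wpDr// le_max lexx orbT.
  exists s^-1; split; first by rewrite invr_gt0.
    by rewrite ler_pdivrMl//; lra.
  by rewrite ler_pdivrMl// -ler_pdivrMr.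
have [y [yy0 yL dy]] : exists y : R -> 'rV[R]_m, [/\ y 0 = y0,
    forall s t, `|y s - y t| <= r * `|s - t| &
    forall t : R, `|t| < 1 -> is_derive t (1 : R) y (e *: F (rho (y t)))].
  apply: (@picard_contraction _ _ (fun u => e *: F (rho u))) => [u|u v].
    rewrite normrZ gtr0_norm//; apply: le_trans eB.
    by rewrite ler_wpM2l ?(ltW e0)//; have [] := UB _ (rho_box u).
  rewrite -scalerBr normrZ gtr0_norm//.
  apply: (@le_trans _ _ (e * (L * `|rho u - rho v|))).
    by rewrite ler_wpM2l ?(ltW e0)//; exact: FL.
  by rewrite mulrA ler_pM// mulr_ge0// ltW.
exists e => //; exists (fun t => y (e^-1 * t)); first by rewrite mulr0.
move=> t te; have t1 : `|e^-1 * t| < 1.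
  by rewrite normrM gtr0_norm ?invr_gt0// ltr_pdivrMl// mulr1.
have yr : `|y (e^-1 * t) - y0| <= r.
  by rewrite -yy0 (le_trans (yL _ _))// subr0 ler_piMr// ltW.
split; first by have [] := UB _ yr.
have dyt := dy _ t1; rewrite rho_id// in dyt.
have [/derivable1_diffP yd ye] := dyt.
have dc : is_derive t (1 : R) (fun s => e^-1 * s) e^-1.
  rewrite -[X in is_derive _ _ _ X]mulr1; apply: is_deriveZ.
have := is_derive_along yd dc.
have -> : 'D_(e^-1) y (e^-1 * t) = e^-1 *: 'D_1 y (e^-1 * t).
  by rewrite !deriveE// -linearZ /= [_ *: _]mulr1.
by rewrite ye scalerA mulVf ?gt_eqF// scale1r.
Qed.

End PicardLindelof.

(** * Leibniz rules for families of linear and bilinear maps *)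

Section Leibniz.
Context {R : realType}.

(** Differentiability is kept together with one directional derivative so that
    both propagate through the same rules. *)
Definition derives (V W : normedModType R) (f : V -> W) x v d :=
  differentiable f x /\ 'D_v f x = d.

Lemma derives_cst (V W : normedModType R) (c : W) (x v : V) :
  derives (fun=> c) x v 0.
Proof. by split; [exact: differentiable_cst|exact: derive_cst]. Qed.

Lemma derives_id (V : normedModType R) (x v : V) : derives id x v v.
Proof. by split; [exact: ex_diff|exact: derive_id]. Qed.

Lemma derivesD (V W : normedModType R) (f g : V -> W) x v df dg :
  derives f x v df -> derives g x v dg ->
  derives (fun y => f y + g y) x v (df + dg).
Proof.
move=> [f1 <-] [g1 <-]; split; first exact: differentiableD.
by apply: deriveD; exact: diff_derivable.
Qed.

Lemma derives_sum (V W : normedModType R) (I : Type) (r : seq I)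
    (f : I -> V -> W) x v (df : I -> W) :
  (forall i, derives (f i) x v (df i)) ->
  derives (fun y => \sum_(i <- r) f i y) x v (\sum_(i <- r) df i).
Proof.
move=> fdf; elim: r => [|i r IH].
  rewrite (_ : (fun y => _) = fun=> 0).
    by rewrite big_nil; exact: derives_cst.
  by apply/funext => y; rewrite big_nil.
rewrite (_ : (fun y => _) = fun y => f i y + \sum_(i <- r) f i y).
  by rewrite big_cons; exact: derivesD.
by apply/funext => y; rewrite big_cons.
Qed.

Lemma near_derives (V W : normedModType R) (f g : V -> W) x v d :
  (\forall y \near x, f y = g y) -> derives f x v d -> derives g x v d.
Proof.
move=> fg [df <-]; split; first exact: near_eq_differentiable df.
by apply/esym; exact: near_eq_derive.
Qed.

Lemma derives_comp (U V W : normedModType R) (f : V -> W) (h : U -> V) x v d :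
  derives h x v d -> differentiable f (h x) ->
  derives (fun y => f (h y)) x v ('D_d f (h x)).
Proof.
move=> [dh <-] df; have dfh : differentiable (f \o h) x.
  exact: differentiable_comp.
by split=> //; rewrite !deriveE// diff_comp.
Qed.

Lemma derives_linear (V W W' : normedModType R) (L : {linear W -> W'})
    (f : V -> W) x v d :
  continuous L -> derives f x v d -> derives (fun y => L (f y)) x v (L d).
Proof.
move=> cL fd; have dL : differentiable L (f x) by exact: linear_differentiable.
by have := derives_comp fd dL; rewrite deriveE// diff_lin.
Qed.

Lemma derivesN (V W : normedModType R) (f : V -> W) x v df :
  derives f x v df -> derives (fun y => - f y) x v (- df).
Proof.
move=> [f1 <-]; split; first exact: differentiableN.
by apply: deriveN; exact: diff_derivable.
Qed.

Lemma scale_is_bilinear (W : normedModType R) :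
  bilinear_for
    (GRing.Scale.Law.clone _ _ *:%R _) (GRing.Scale.Law.clone _ _ *:%R _)
    (fun (k : R) (w : W) => k *: w).
Proof.
split=> [w|k] a x y /=.
- by rewrite scalerDl scalerA.
- by rewrite scalerDr !scalerA mulrC.
Qed.

Lemma derivesZ (V W : normedModType R) (k : V -> R) (f : V -> W) x v dk df :
  derives k x v dk -> derives f x v df ->
  derives (fun y => k y *: f y) x v (dk *: f x + k x *: df).
Proof.
move=> [k1 <-] [f1 <-].
pose bM := bilinear_isBilinear.Build R R W W _ _ _ (scale_is_bilinear W).
pose b : {bilinear R -> W -> W} := HB.pack (fun (k : R) (w : W) => k *: w) bM.
have cb : continuous (fun p => b p.1 p.2) by move=> p; exact: scale_continuous.
have dp : differentiable (fun y => (k y, f y)) x by exact: differentiable_pair.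
have db : differentiable (fun p => b p.1 p.2) (k x, f x).
  exact: differentiable_bilin.
have db' : differentiable ((fun p => b p.1 p.2) \o (fun y => (k y, f y))) x.
  exact: differentiable_comp.
split; first exact: db'.
rewrite deriveE; last exact: db'.
rewrite (diff_comp dp db) /=.
have /(congr1 (fun F => F ('d k x v, 'd f x v))) /= := diff_bilin (k x, f x) cb.
have -> : 'd (fun y => (k y, f y)) x v = ('d k x v, 'd f x v).
  by rewrite diff_pair.
by move=> ->; rewrite !deriveE// addrC.
Qed.

Lemma linear0E (V W : lmodType R) (f : V -> W) : linear f -> f 0 = 0.
Proof.
move=> lf; have := lf 1 0 0; rewrite scaler0 addr0 scale1r.
by move/(congr1 (+%R (- f 0))); rewrite addNr addKr.
Qed.

Lemma linear_rowE m (W : lmodType R) (L : 'rV[R]_m -> W) v :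
  linear L -> L v = \sum_a v 0 a *: L (delta_mx 0 a).
Proof.
move=> lL; pose lM := GRing.isLinear.Build _ _ _ _ _ lL.
pose lf : {linear _ -> _} := HB.pack L lM.
rewrite -[L]/(lf : _ -> _) [in LHS](row_sum_delta v) linear_sum.
by apply: eq_bigr => a _; rewrite linearZ.
Qed.

Lemma derives_coord (V : normedModType R) m (f : V -> 'rV[R]_m) x v d b :
  derives f x v d -> derives (fun y => f y 0 b) x v (d 0 b).
Proof.
pose h (N : 'rV[R]_m) : R := N 0 b.
have hlin : linear h by move=> r u w; rewrite /h !mxE.
pose hM := GRing.isLinear.Build _ _ _ _ _ hlin.
pose hL : {linear 'rV[R]_m -> R} := HB.pack h hM.
by apply: (@derives_linear _ _ _ hL); exact: coord_continuous.
Qed.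

(** The map L y is linear only for y near x, so it is replaced there by its
    expansion on the canonical basis, which is a finite sum of products. *)
Lemma derives_linear_family (V W : normedModType R) m
    (L : V -> 'rV[R]_m -> W) (f : V -> 'rV[R]_m) x v dL df :
  (\forall y \near x, linear (L y)) ->
  (forall w, derives (L^~ w) x v (dL w)) ->
  derives f x v df ->
  derives (fun y => L y (f y)) x v (dL (f x) + L x df).
Proof.
move=> lL LdL fdf; have lLx := nbhs_singleton lL.
apply: (@near_derives _ _
  (fun y => \sum_a f y 0 a *: L y (delta_mx 0 a))).
  by near=> y; rewrite -linear_rowE//; near: y.
have -> : dL (f x) + L x df =
    \sum_a (df 0 a *: L x (delta_mx 0 a) + f x 0 a *: dL (delta_mx 0 a)).
  rewrite big_split /= -linear_rowE// addrC; congr (_ + _).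
  have [_ <-] := LdL (f x).
  have [_ ->//] : derives (L^~ (f x)) x v
      (\sum_a f x 0 a *: dL (delta_mx 0 a)).
  apply: (@near_derives _ _ (fun y => \sum_a f x 0 a *: L y (delta_mx 0 a))).
    by near=> y; rewrite -linear_rowE//; near: y.
  apply: derives_sum => a.
  rewrite -[_ *: dL _]add0r -(scale0r (L x (delta_mx 0 a))).
  by apply: derivesZ; [exact: derives_cst|exact: LdL].
apply: derives_sum => a; apply: derivesZ; first exact: derives_coord.
exact: LdL.
Unshelve. all: by end_near. Qed.

Lemma derives_bilinear_family (V W : normedModType R) m p
    (B : V -> 'rV[R]_m -> 'rV[R]_p -> W) (f : V -> 'rV[R]_m)
    (h : V -> 'rV[R]_p) x v dB df dh :
  (\forall y \near x, forall w, linear (B y ^~ w)) ->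
  (\forall y \near x, forall u, linear (B y u)) ->
  (forall u w, derives (fun y => B y u w) x v (dB u w)) ->
  derives f x v df -> derives h x v dh ->
  derives (fun y => B y (f y) (h y)) x v
    (dB (f x) (h x) + B x df (h x) + B x (f x) dh).
Proof.
move=> lBl lBr BdB fdf hdh.
apply: (@derives_linear_family _ _ _ (fun y => B y (f y)) h x v
  (fun w => dB (f x) w + B x df w)) => // [|w].
  by apply: filterS lBr => y ly; exact: ly.
apply: (@derives_linear_family _ _ _ (fun y => B y ^~ w) f x v (dB^~ w)) => //.
by apply: filterS lBl => y ly; exact: ly.
Qed.

End Leibniz.

(** * Horizontal and vertical lifts in a chart *)

Section Curves.
Context {R : realType}.

Lemma derives1P (W : normedModType R) (f : R -> W) t d :
  derives f t (1 : R) d <-> is_derive t (1 : R) f d.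
Proof.
split=> [[df <-]|[df <-]]; last by split=> //; apply/derivable1_diffP.
by apply: DeriveDef => //; apply/derivable1_diffP.
Qed.

Lemma derives_row_mx (V : normedModType R) m p (f : V -> 'rV[R]_m)
    (h : V -> 'rV[R]_p) x v df dh :
  derives f x v df -> derives h x v dh ->
  derives (fun y => row_mx (f y) (h y)) x v (row_mx df dh).
Proof.
move=> fdf hdh.
have lin1 : linear (fun u : 'rV[R]_m => row_mx u (0 : 'rV[R]_p)).
  by move=> a u w; rewrite scale_row_mx add_row_mx scaler0 addr0.
have lin2 : linear (fun u : 'rV[R]_p => row_mx (0 : 'rV[R]_m) u).
  by move=> a u w; rewrite scale_row_mx add_row_mx scaler0 addr0.
have -> : row_mx df dh = row_mx df 0 + row_mx 0 dh.
  by rewrite add_row_mx addr0 add0r.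
rewrite (_ : (fun y => _) =
  fun y => row_mx (f y) 0 + row_mx 0 (h y)); last first.
  by apply/funext => y; rewrite add_row_mx addr0 add0r.
pose M1 := GRing.isLinear.Build _ _ _ _ _ lin1.
pose L1 : {linear _ -> _} :=
  HB.pack (fun u : 'rV[R]_m => row_mx u (0 : 'rV[R]_p)) M1.
pose M2 := GRing.isLinear.Build _ _ _ _ _ lin2.
pose L2 : {linear _ -> _} :=
  HB.pack (fun u : 'rV[R]_p => row_mx (0 : 'rV[R]_m) u) M2.
have c1 : continuous L1.
  apply: (@lipschitz_continuous _ _ _ _ 1) => u w; rewrite mul1r /=.
  apply/(row_normP _ (normr_ge0 _)) => j.
  rewrite opp_row_mx add_row_mx subrr; have := splitK j.
  case: (fintype.split j) => {}j <- /=; last by rewrite row_mxEr mxE normr0.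
  by rewrite row_mxEl row_norm_coord.
have c2 : continuous L2.
  apply: (@lipschitz_continuous _ _ _ _ 1) => u w; rewrite mul1r /=.
  apply/(row_normP _ (normr_ge0 _)) => j.
  rewrite opp_row_mx add_row_mx subrr; have := splitK j.
  case: (fintype.split j) => {}j <- /=; first by rewrite row_mxEl mxE normr0.
  by rewrite row_mxEr row_norm_coord.
apply: derivesD.
  exact: (derives_linear c1).
exact: (derives_linear c2).
Qed.

Section Velocity.
Context {n : nat} {M : manifold R n}.
Implicit Types (i j : chart M).

(** The chain rule for the transition maps gives the velocity in every other
    chart. *)
Lemma has_velocity_par i (x : R -> 'rV[R]_n) t v : dom i (x t) ->
  is_derive t (1 : R) x v ->
  has_velocity (fun s => par i (x s)) t (cvec i (x t) v).
Proof.
move=> dx xv; split=> // j jx.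
have oij : overlap i j (x t) by split.
have cx : {for t, continuous x}.
  by apply: differentiable_continuous; apply/derivable1_diffP; case: xv.
split.
  have : \forall s \near t, overlap i j (x s).
    by apply: cx; apply: open_nbhs_nbhs; split=> //; exact: overlap_open.
  by apply: filterS => s [].
rewrite /= /cvec_crd asboolT//.
apply: is_derive_along => //; exact: transition_diff.
Qed.

(** The equation of parallel transport may be checked in a single chart: the
    second derivative of the transition map that appears in another chart is
    absorbed by the transformation rule of the Christoffel symbols. *)
Lemma parallel_at_cvec (D : connection M) i (x c : R -> 'rV[R]_n) t v :
  dom i (x t) -> is_derive t (1 : R) x v ->
  is_derive t (1 : R) c (- D i (x t) v (c t)) ->
  parallel_at D (fun s => cvec i (x s) (c s)) t (cvec i (x t) v).
Proof.
move=> dx xv cv j jx.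
have oij : overlap i j (x t) by split.
have cx : {for t, continuous x}.
  by apply: differentiable_continuous; apply/derivable1_diffP; case: xv.
have nij : \forall s \near t, overlap i j (x s).
  by apply: cx; apply: open_nbhs_nbhs; split=> //; exact: overlap_open.
rewrite /= /cvec_crd !asboolT//.
apply/derives1P; apply: (@near_derives _ _ _
    (fun s => 'D_(c s) (transition i j) (x s))).
  by near=> s; rewrite asboolT//; near: s.
rewrite -[crd j _]/(transition i j (x t)).
have := @christoffel_transition _ _ _ D i j (x t) v (c t) oij.
move=> /= E.
have -> : - D j (transition i j (x t)) ('D_v (transition i j) (x t))
    ('D_(c t) (transition i j) (x t)) =
  'D_v (fun y => 'D_(c t) (transition i j) y) (x t) +
  'D_(- D i (x t) v (c t)) (transition i j) (x t).
  have dt := transition_diff oij.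
  rewrite [X in _ = _ + X]deriveE// linearN -deriveE// E.
  by rewrite opprD addrA subrr sub0r.
apply: (@derives_linear_family _ _ _ _ (fun s w => 'D_w (transition i j) (x s)) c
   t 1 (fun w => 'D_v (fun y => 'D_w (transition i j) y) (x t))).
- apply: filterS nij => s /transition_diff dt a u w.
  by rewrite !deriveE// linearP.
- move=> w; apply: derives_comp; first exact/derives1P.
  have [_ Dt] := @transition_smooth _ _ M i j 2.
  by have [dDt _] := Dt w; exact: dDt.
- exact/derives1P.
Unshelve. all: by end_near. Qed.

End Velocity.

Section Lifts.
Context {n : nat} {M : manifold R n}.
Implicit Types (i j : chart M) (D : connection M).

Lemma Ck_id (V : normedModType R) k (U : set V) : Ck k U (@id V).
Proof.
elim: k => [|k _] /=; first by move=> x _; exact: cvg_id.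
split=> [x _|v]; first exact: ex_diff.
rewrite [X in Ck _ _ X](_ : _ = fun=> v); first exact: Ck_cst.
by apply/funext => x; exact: derive_id.
Qed.

Lemma christoffel_rowE D i x u w : dom i x ->
  D i x u w = \sum_a \sum_b
    (u 0 a * w 0 b) *: D i x (delta_mx 0 a) (delta_mx 0 b).
Proof.
move=> dx; rewrite (linear_rowE _ (@christoffel_linearl _ _ _ D i x w dx)).
apply: eq_bigr => a _.
rewrite (linear_rowE _ (@christoffel_linearr _ _ _ D i x (delta_mx 0 a) dx)).
by rewrite scaler_sumr; apply: eq_bigr => b _; rewrite scalerA.
Qed.

Lemma Ck_christoffel D i (V : normedModType R) (L : {linear V -> 'rV[R]_n}) k
    (u w : V -> 'rV[R]_n) : continuous L ->
  let U := L @^-1` dom i in Ck k U u -> Ck k U w ->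
  Ck k U (fun z => D i (L z) (u z) (w z)).
Proof.
move=> cL U Cu Cw; have oU : open U.
  by apply: open_comp => [z _|]; [exact: cL|exact: dom_open].
apply: Ck_row => // j.
apply: (@Ck_ext _ _ _ U k (fun z => \sum_a \sum_b
   (u z 0 a * w z 0 b) * D i (L z) (delta_mx 0 a) (delta_mx 0 b) 0 j)) => //.
  move=> z Uz; rewrite christoffel_rowE// summxE; apply: eq_bigr => a _.
  by rewrite summxE; apply: eq_bigr => b _; rewrite mxE.
apply: Ck_sum => // a; apply: Ck_sum => // b; apply: CkM => //.
  by apply: CkM => //; exact: Ck_coord.
apply: Ck_coord => //; apply: (@Ck_linr _ _ _ _ L _ k (fun x => D i x _ _)) => //.
  exact: dom_open.
exact: christoffel_smooth.
Qed.

(** A geodesic y with velocity w, and a field d parallel along it, are the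
    components of an integral curve of
      (x, v, c) |-> (v, - D(x; v, v), - D(x; v, c)),
    which is smooth because D is bilinear with smooth coefficients. *)
Lemma geodesic_transport D i x v c : dom i x ->
  exists2 e : R, 0 < e & exists y w d : R -> 'rV[R]_n,
  [/\ y 0 = x, w 0 = v, d 0 = c & forall t : R, `|t| < e ->
  [/\ dom i (y t), is_derive t (1 : R) y (w t),
    is_derive t (1 : R) w (- D i (y t) (w t) (w t)) &
    is_derive t (1 : R) d (- D i (y t) (w t) (d t))]].
Proof.
move=> dx; pose V := 'rV[R]_(n + (n + n)).
pose py : {linear V -> 'rV[R]_n} := lsubmx.
pose pw : {linear V -> 'rV[R]_n} := lsubmx \o rsubmx.
pose pd : {linear V -> 'rV[R]_n} := rsubmx \o rsubmx.
have cy : continuous py by exact: continuous_lsubmx.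
have cw : continuous pw.
  move=> z; apply: continuous_comp; first exact: continuous_rsubmx.
  exact: continuous_lsubmx.
have cd : continuous pd.
  move=> z; apply: continuous_comp; first exact: continuous_rsubmx.
  exact: continuous_rsubmx.
pose U : set V := py @^-1` dom i.
have oU : open U by apply: open_comp => [z _|]; [exact: cy|exact: dom_open].
pose F (z : V) : V := row_mx (pw z)
  (row_mx (- D i (py z) (pw z) (pw z)) (- D i (py z) (pw z) (pd z))).
have Cpw : Ck 1 U pw by apply: (@Ck_linl _ _ _ _ pw U 1 id) => //; exact: Ck_id.
have Cpd : Ck 1 U pd by apply: (@Ck_linl _ _ _ _ pd U 1 id) => //; exact: Ck_id.
have CN (f : V -> 'rV[R]_n) : Ck 1 U f -> Ck 1 U (fun z => - f z).
  move=> Cf; pose N : {linear 'rV[R]_n -> 'rV[R]_n} := -%R.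
  apply: (@Ck_linl _ _ _ _ N) => //; exact: opp_continuous.
have CG (f : V -> 'rV[R]_n) : Ck 1 U f ->
    Ck 1 U (fun z => - D i (py z) (pw z) (f z)).
  move=> Cf; apply: CN.
  exact: (@Ck_christoffel D i V py 1 pw f cy Cpw Cf).
have CF : Ck 1 U F.
  apply: Ck_row => // b; have := splitK b; case: (fintype.split b) => {}b <- /=.
    apply: (@Ck_ext _ _ _ U 1 (fun z => pw z 0 b)) => //; last exact: Ck_coord.
    by move=> z _; rewrite row_mxEl.
  have := splitK b; case: (fintype.split b) => {}b <- /=.
    apply: (@Ck_ext _ _ _ U 1 (fun z => (- D i (py z) (pw z) (pw z)) 0 b)) => //.
      by move=> z _; rewrite row_mxEr row_mxEl.
    exact: (Ck_coord _ oU (CG _ Cpw)).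
  apply: (@Ck_ext _ _ _ U 1 (fun z => (- D i (py z) (pw z) (pd z)) 0 b)) => //.
    by move=> z _; rewrite row_mxEr row_mxEr.
  exact: (Ck_coord _ oU (CG _ Cpd)).
have U0 : U (row_mx x (row_mx v c)) by rewrite /U /= row_mxKl.
have [e e0 [z z0 dz]] := picard_lindelof oU CF U0.
exists e => //; exists (py \o z), (pw \o z), (pd \o z).
split; rewrite /= ?z0 ?row_mxKr ?row_mxKl// => t /dz[Uz] /derives1P zF.
split=> //; apply/derives1P.
- by have := derives_linear cy zF; rewrite /F /= row_mxKl.
- by have := derives_linear cw zF; rewrite /F /= row_mxKr row_mxKl.
- by have := derives_linear cd zF; rewrite /F /= row_mxKr row_mxKr.
Qed.

Lemma horizontal_lift_exists D i x xi u : dom i x ->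
  horizontal_lift D (cvec i x xi) (cvec i x u)
    (@cvec _ _ (tangent_bundle M) i (row_mx x xi) (row_mx u (- D i x u xi))).
Proof.
move=> dx.
have [e e0 [y [w [d [y0 w0 d0 H]]]]] := geodesic_transport D u xi dx.
exists e => //.
exists (fun t => cvec i (y t) (w t)), (fun t => cvec i (y t) (d t)).
split=> [t /H[dy yw ww dd]|||]; rewrite ?y0 ?w0 ?d0//.
  split=> //; first exact: has_velocity_par.
    exact: parallel_at_cvec.
  exact: parallel_at_cvec.
have [dy yw ww dd] : [/\ dom i (y 0), is_derive 0 (1 : R) y (w 0),
    is_derive 0 (1 : R) w (- D i (y 0) (w 0) (w 0)) &
    is_derive 0 (1 : R) d (- D i (y 0) (w 0) (d 0))].
  by apply: H; rewrite normr0.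
pose z t : 'rV[R]_(n + n) := row_mx (y t) (d t).
have zv : is_derive 0 (1 : R) z (row_mx u (- D i x u xi)).
  apply/derives1P; apply: derives_row_mx; apply/derives1P.
    by rewrite -w0.
  by rewrite -d0 -w0 -y0.
have dz : tb_dom i (z 0) by rewrite /tb_dom /= row_mxKl.
have := @has_velocity_par _ (tangent_bundle M) i z 0 _ dz zv.
rewrite {2}/z y0 d0.
rewrite (_ : (fun s => _) = fun t => cvec i (y t) (d t))//.
by apply/funext => t; rewrite /= /tb_par /z row_mxKl row_mxKr.
Qed.

Lemma vertical_lift_exists i x xi w : dom i x ->
  vertical_lift (cvec i x xi) (cvec i x w)
    (@cvec _ _ (tangent_bundle M) i (row_mx x xi) (row_mx 0 w)).
Proof.
move=> dx; exists (fun t => cvec i x (xi + t *: w)).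
split=> [t|].
  split=> // j; rewrite /= /cvec_crd; case: asboolP => [oij|_].
    have dt := transition_diff oij.
    by rewrite !deriveE// linearD linearZ.
  by rewrite scaler0 addr0.
pose z (t : R) : 'rV[R]_(n + n) := row_mx x (xi + t *: w).
have zv : is_derive 0 (1 : R) z (row_mx 0 w).
  apply/derives1P; apply: derives_row_mx; first exact: derives_cst.
  rewrite -[w in X in derives _ _ _ X]add0r; apply: derivesD.
    exact: derives_cst.
  have dl : is_diff (0 : R) ( *:%R^~ w) ( *:%R^~ w) by exact: is_diff_scalel.
  by split; [exact: ex_diff|rewrite deriveE// diff_val scale1r].
have dz : tb_dom i (z 0) by rewrite /tb_dom /= row_mxKl.
have := @has_velocity_par _ (tangent_bundle M) i z 0 _ dz zv.
rewrite {2}/z scale0r addr0.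
rewrite (_ : (fun s => _) = fun t => cvec i x (xi + t *: w))//.
by apply/funext => t; rewrite /= /tb_par /z row_mxKl row_mxKr.
Qed.

Lemma vertical_liftE i xi X A : in_chart i (foot xi) -> vertical_lift xi X A ->
  foot A = xi /\ tcrd A i = row_mx 0 (tcrd X i).
Proof.
move=> xi_i [c [cP [fA vA]]].
have c0 : c 0 = xi.
  apply: tangent_eq => [|j]; first by have [] := cP 0.
  by have [_ ->] := cP 0; rewrite scale0r addr0.
split; first by rewrite fA.
have ci : @in_chart _ _ (tangent_bundle M) i (c 0) by apply/tb_in_chart; rewrite c0.
have [_ dc] := vA i ci.
have dl : is_diff (0 : R) ( *:%R^~ (tcrd X i)) ( *:%R^~ (tcrd X i)).
  exact: is_diff_scalel.
have dc' : is_derive 0 (1 : R) (fun s => @crd _ _ (tangent_bundle M) i (c s))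
    (row_mx 0 (tcrd X i)).
  rewrite (_ : (fun s => _) =
    fun s => row_mx (crd i (foot xi)) (tcrd xi i + s *: tcrd X i)); last first.
    by apply/funext => s; rewrite /= /tb_crd; have [-> ->] := cP s.
  apply/derives1P; apply: derives_row_mx; first exact: derives_cst.
  rewrite -[tcrd X i in X in derives _ _ _ X]add0r; apply: derivesD.
    exact: derives_cst.
  by split; [exact: ex_diff|rewrite deriveE// diff_val scale1r].
by have [_ <-] := dc; have [_ <-] := dc'.
Qed.

Lemma horizontal_liftE D i xi X A : in_chart i (foot xi) ->
  horizontal_lift D xi X A ->
  foot A = xi /\ tcrd A i =
    row_mx (tcrd X i) (- D i (crd i (foot xi)) (tcrd X i) (tcrd xi i)).
Proof.
move=> xi_i [e e0 [V [c [cP V0 c0 [fA vA]]]]].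
split; first by rewrite fA.
have ci : @in_chart _ _ (tangent_bundle M) i (c 0) by apply/tb_in_chart; rewrite c0.
have [_ dc] := vA i ci.
have [fcV [_ vV] _ pc] : [/\ foot (c 0) = foot (V 0),
  has_velocity (fun s => foot (V s)) 0 (V 0),
  parallel_at D V 0 (V 0) & parallel_at D c 0 (V 0)] by apply: cP; rewrite normr0.
have dc' : is_derive 0 (1 : R) (fun s => @crd _ _ (tangent_bundle M) i (c s))
    (row_mx (tcrd X i) (- D i (crd i (foot xi)) (tcrd X i) (tcrd xi i))).
  apply/derives1P; apply: derives_row_mx; last first.
    by apply/derives1P; rewrite -V0 -c0; apply: pc; rewrite c0.
  apply: (@near_derives _ _ _ (fun s => crd i (foot (V s)))).
    near=> s; have [-> //] : [/\ foot (c s) = foot (V s),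
      has_velocity (fun s => foot (V s)) s (V s),
      parallel_at D V s (V s) & parallel_at D c s (V s)].
    apply: cP; near: s; apply: (cvgr_norm_lt 0); first exact: cvg_id.
    by rewrite normr0.
  apply/derives1P; rewrite -V0; apply: (vV i _).2.
  by rewrite -fcV c0.
by have [_ <-] := dc; have [_ <-] := dc'.
Unshelve. all: by end_near. Qed.

End Lifts.
End Curves.

(** * Metrics and connections in a chart *)

Section MetricAlgebra.
Context {R : realType} {n : nat} {M : manifold R n}.
Implicit Types (i : chart M) (g : metric M) (D : connection M).

Definition ip g i x u v : R := g (cvec i x u) (cvec i x v).

Section Pointwise.
Variables (g : metric M) (i : chart M) (x : 'rV[R]_n).
Hypothesis dx : dom i x.
Local Notation "<[ u , v ]>" := (ip g i x u v).

Lemma ipC u v : <[u, v]> = <[v, u]>.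
Proof. exact: Defs.metric_sym. Qed.

Lemma ip_linearl v : linear (fun u => <[u, v]>).
Proof. exact: metric_linear. Qed.

Lemma ip_linearr u : linear (fun v => <[u, v]>).
Proof. by move=> a v w; rewrite ipC ip_linearl !(ipC u). Qed.

Lemma ipDl u v w : <[u + v, w]> = <[u, w]> + <[v, w]>.
Proof. by have := ip_linearl w 1 u v; rewrite !scale1r. Qed.

Lemma ip0l w : <[0, w]> = 0.
Proof. by apply: (addrI <[0, w]>); rewrite -ipDl !addr0. Qed.

Lemma ipZl a u w : <[a *: u, w]> = a * <[u, w]>.
Proof. by have := ip_linearl w a u 0; rewrite !addr0 ip0l addr0. Qed.

Lemma ipNl u w : <[- u, w]> = - <[u, w]>.
Proof. by rewrite -scaleN1r ipZl mulN1r. Qed.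

Lemma ipBl u v w : <[u - v, w]> = <[u, w]> - <[v, w]>.
Proof. by rewrite ipDl ipNl. Qed.

Lemma ipDr u v w : <[w, u + v]> = <[w, u]> + <[w, v]>.
Proof. by rewrite ipC ipDl !(ipC w). Qed.

Lemma ip0r w : <[w, 0]> = 0.
Proof. by rewrite ipC ip0l. Qed.

Lemma ipZr a u w : <[w, a *: u]> = a * <[w, u]>.
Proof. by rewrite ipC ipZl (ipC w). Qed.

Lemma ipNr u w : <[w, - u]> = - <[w, u]>.
Proof. by rewrite ipC ipNl (ipC w). Qed.

Lemma ipBr u v w : <[w, u - v]> = <[w, u]> - <[w, v]>.
Proof. by rewrite ipDr ipNr. Qed.

(** Vectors determined by Koszul-type formulas are identified through their
    products with all vectors, by positivity. *)
Lemma ip_inj u v : (forall w, <[u, w]> = <[v, w]>) -> u = v.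
Proof.
move=> uv; apply/eqP; rewrite -subr_eq0; apply/negP => /negP uv0.
by have := metric_gt0 g dx uv0; rewrite -/(ip _ _ _ _ _) ipBl uv subrr ltxx.
Qed.
End Pointwise.

Lemma near_dom i x : dom i x -> \forall y \near x, dom i y.
Proof. by move=> dx; apply: open_nbhs_nbhs; split=> //; exact: dom_open. Qed.

Lemma ip_smooth g i u v k : Ck k (dom i) (fun y => ip g i y u v).
Proof. exact: metric_smooth. Qed.

Definition dip g i w x u v : R := 'D_w (fun y => ip g i y u v) x.

Lemma dipC g i w x u v : dip g i w x u v = dip g i w x v u.
Proof.
rewrite /dip (_ : (fun y => ip g i y u v) = fun y => ip g i y v u)//.
by apply/funext => y; exact: ipC.
Qed.

Lemma derives_ip g i x w u v : dom i x ->
  derives (fun y => ip g i y u v) x w (dip g i w x u v).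
Proof. by move=> dx; split=> //; have [+ _] := ip_smooth g i u v 1; exact. Qed.

Definition dchr D i w x u v : 'rV[R]_n := 'D_w (fun y => D i y u v) x.

Lemma derives_christoffel D i x w u v : dom i x ->
  derives (fun y => D i y u v) x w (dchr D i w x u v).
Proof.
by move=> dx; split=> //; have [+ _] := @christoffel_smooth _ _ _ D i u v 1; exact.
Qed.

(** The base point moves along an arbitrary map L, which will be the projection
    of TM to M as well as the identity. *)
Lemma derives_ip_fields g i (V : normedModType R) (L : V -> 'rV[R]_n)
    (f h : V -> 'rV[R]_n) z v dL df dh : dom i (L z) ->
  derives L z v dL -> derives f z v df -> derives h z v dh ->
  derives (fun y => ip g i (L y) (f y) (h y)) z v
    (dip g i dL (L z) (f z) (h z) + ip g i (L z) df (h z)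
     + ip g i (L z) (f z) dh).
Proof.
move=> dz LdL fdf hdh.
have nL : \forall y \near z, dom i (L y).
  have [dLz _] := LdL; apply: (differentiable_continuous dLz).
  exact: near_dom.
apply: (@derives_bilinear_family _ _ _ _ _ (fun y => ip g i (L y)) f h z v
  (dip g i dL (L z)) df dh _ _ _ fdf hdh).
- by apply: filterS nL => y dy w; exact: ip_linearl.
- by apply: filterS nL => y dy w; exact: ip_linearr.
- move=> u w; have [dip_ _] := derives_ip g dL u w dz.
  exact: (derives_comp (f := fun y => ip g i y u w) LdL).
Qed.

Lemma derives_christoffel_fields D i (V : normedModType R) (L : V -> 'rV[R]_n)
    (f h : V -> 'rV[R]_n) z v dL df dh : dom i (L z) ->
  derives L z v dL -> derives f z v df -> derives h z v dh ->
  derives (fun y => D i (L y) (f y) (h y)) z v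
    (dchr D i dL (L z) (f z) (h z) + D i (L z) df (h z)
     + D i (L z) (f z) dh).
Proof.
move=> dz LdL fdf hdh.
have nL : \forall y \near z, dom i (L y).
  have [dLz _] := LdL; apply: (differentiable_continuous dLz).
  exact: near_dom.
apply: (@derives_bilinear_family _ _ _ _ _ (fun y => D i (L y)) f h z v
  (dchr D i dL (L z)) df dh _ _ _ fdf hdh).
- by apply: filterS nL => y dy w; exact: christoffel_linearl.
- by apply: filterS nL => y dy w; exact: christoffel_linearr.
- move=> u w; have [dD _] := derives_christoffel D dL u w dz.
  exact: (derives_comp (f := fun y => D i y u w) LdL).
Qed.

Lemma smooth_cst i (c : 'rV[R]_n) : smooth (dom i) (cst c : 'rV[R]_n -> 'rV[R]_n).
Proof. by move=> k; exact: Ck_cst. Qed.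

Lemma nabla_cst D i u v x : nabla D i (cst u) (cst v) x = D i x u v.
Proof. by rewrite /nabla derive_cst add0r. Qed.

Lemma bracket_cst (u v : 'rV[R]_n) : bracket (cst u) (cst v) = cst 0.
Proof. by apply/funext => x; rewrite /bracket !derive_cst subrr. Qed.

Lemma torsion_free_sym D i x u v : torsion_free D -> dom i x ->
  D i x u v = D i x v u.
Proof.
move=> tD dx; have := tD i _ _ (smooth_cst i u) (smooth_cst i v) x dx.
rewrite /torsion !nabla_cst bracket_cst subr0 => /eqP.
by rewrite subr_eq0 => /eqP.
Qed.

Lemma nabla_metric_cst D g i u v w x :
  nabla_metric D g i (cst u) (cst v) (cst w) x =
  dip g i u x v w - ip g i x (D i x u v) w - ip g i x v (D i x u w).
Proof. by rewrite /nabla_metric /metric_field !nabla_cst. Qed.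

Lemma christoffel0l D i x w : dom i x -> D i x 0 w = 0.
Proof.
by move=> dx; exact: (linear0E (@christoffel_linearl _ _ _ D i x w dx)).
Qed.

Lemma christoffel0r D i x w : dom i x -> D i x w 0 = 0.
Proof.
by move=> dx; exact: (linear0E (@christoffel_linearr _ _ _ D i x w dx)).
Qed.

Lemma christoffelNr D i x u w : dom i x -> D i x u (- w) = - D i x u w.
Proof.
move=> dx; have := @christoffel_linearr _ _ _ D i x u dx (-1) w 0.
by rewrite !scaleN1r !addr0 christoffel0r// addr0.
Qed.

Lemma curvature_field_cst D i x u v w : dom i x ->
  curvature_field D i (cst u) (cst v) (cst w) x =
  dchr D i u x v w + D i x u (D i x v w)
  - (dchr D i v x u w + D i x v (D i x u w)).
Proof.
move=> dx; rewrite /curvature_field bracket_cst.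
have e a b : nabla D i (cst a) (cst b) = fun y => D i y a b.
  by apply/funext => y; exact: nabla_cst.
by rewrite !e /nabla /= christoffel0l// subr0.
Qed.

End MetricAlgebra.

Section LeviCivita.
Context {R : realType} {n : nat} {M : manifold R n}.
Variables (g : metric M) (Dg : connection M).
Hypothesis Dg_lc : levi_civita g Dg.
Implicit Types (i : chart M).

Lemma lc_sym i x u v : dom i x -> Dg i x u v = Dg i x v u.
Proof. by case: Dg_lc => tD _; exact: torsion_free_sym. Qed.

Lemma lc_metric i x u v w : dom i x ->
  dip g i u x v w = ip g i x (Dg i x u v) w + ip g i x v (Dg i x u w).
Proof.
move=> dx; case: Dg_lc => _ mD.
have := mD i _ _ _ (smooth_cst i u) (smooth_cst i v) (smooth_cst i w) x dx.
by rewrite nabla_metric_cst => /eqP; rewrite -addrA -opprD subr_eq0 => /eqP.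
Qed.

Lemma koszul i x u v w : dom i x ->
  ip g i x (Dg i x u v) w =
  2^-1 * (dip g i u x v w + dip g i v x u w - dip g i w x u v).
Proof.
move=> dx; rewrite !lc_metric// (lc_sym w u dx) (lc_sym v u dx) (lc_sym w v dx).
rewrite (ipC g i x v (Dg i x u w)) (ipC g i x u (Dg i x v w)).
lra.
Qed.

(** The derivatives of Gamma(b,b) and Gamma(a,b) paired with a are obtained by
    differentiating Koszul's expressions for G(Gamma(b,b), a) and
    G(Gamma(a,b), a); compatibility with the metric takes care of the
    derivative of G. *)
Lemma lc_curvature i x a b : dom i x ->
  ip g i x (curvature_field Dg i (cst a) (cst b) (cst b) x) a =
  'D_a (fun y => dip g i b y a b) x
  - 2^-1 * 'D_a (fun y => dip g i a y b b) x
  - 2^-1 * 'D_b (fun y => dip g i b y a a) x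
  + ip g i x (Dg i x a b) (Dg i x a b) - ip g i x (Dg i x a a) (Dg i x b b).
Proof.
move=> dx.
have ddip u v w c : derives (fun y => dip g i u y v w) x c
    ('D_c (fun y => dip g i u y v w) x).
  by split=> //; have [_ /(_ u) [+ _]] := ip_smooth g i v w 2; exact.
have aux c u v : ip g i x (dchr Dg i c x u v + Dg i x c (Dg i x u v)) a =
    'D_c (fun y => ip g i y (Dg i y u v) a) x - ip g i x (Dg i x u v) (Dg i x c a).
  have [_ ->] := derives_ip_fields g dx (derives_id x c)
    (derives_christoffel Dg c u v dx) (derives_cst a x c).
  rewrite lc_metric// ip0r// addr0 ipDl//; lra.
rewrite curvature_field_cst// ipBl// !aux.
have Dbb : 'D_a (fun y => ip g i y (Dg i y b b) a) x =
   'D_a (fun y => dip g i b y a b) x - 2^-1 * 'D_a (fun y => dip g i a y b b) x.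
  have : derives (fun y => dip g i b y a b + (- 2^-1) *: dip g i a y b b) x a
     ('D_a (fun y => dip g i b y a b) x +
      (0 *: dip g i a x b b + (- 2^-1) *: 'D_a (fun y => dip g i a y b b) x)).
    by apply: derivesD => //; apply: derivesZ => //; exact: derives_cst.
  rewrite scale0r add0r [_ *: _]mulNr => -[_ <-]; apply: near_eq_derive.
  apply: filterS (near_dom dx) => y dy; rewrite koszul// (dipC _ _ b y b a).
  by rewrite [_ *: _]mulNr; lra.
have Dab : 'D_b (fun y => ip g i y (Dg i y a b) a) x =
   2^-1 * 'D_b (fun y => dip g i b y a a) x.
  have : derives (fun y => 2^-1 *: dip g i b y a a) x b
     (0 *: dip g i b x a a + 2^-1 *: 'D_b (fun y => dip g i b y a a) x).
    by apply: derivesZ => //; exact: derives_cst.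
  rewrite scale0r add0r => -[_ H].
  apply: (etrans _ H) => {H Dbb}; apply: near_eq_derive.
  apply: filterS (near_dom dx) => y dy; rewrite koszul// (dipC _ _ a y b a).
  by rewrite -[RHS]/(2^-1 * dip g i b y a a); lra.
rewrite {}Dbb {}Dab (lc_sym b a dx) (ipC g i x (Dg i x b b)).
suff E (p q r s t : R) :
  p - 2^-1 * q - s - (2^-1 * r - t) = p - 2^-1 * q - 2^-1 * r + t - s by exact: E.
lra.
Qed.

End LeviCivita.

(** * Statistical structures and the Sasakian metric *)

Section Statistical.
Context {R : realType} {n : nat} {M : manifold R n}.
Variables (g : metric M) (D Dg : connection M).
Hypotheses (gD : statistical g D) (Dg_lc : levi_civita g Dg).
Implicit Types (i : chart M).

Lemma stat_sym i x u v : dom i x -> D i x u v = D i x v u.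
Proof. by case: gD => tD _; exact: torsion_free_sym. Qed.

(** The tensor K of the statistical structure, in coordinates. *)
Definition Kcoef i x u v : 'rV[R]_n := D i x u v - Dg i x u v.

Lemma K_sym i x u v : dom i x -> Kcoef i x u v = Kcoef i x v u.
Proof. by move=> dx; rewrite /Kcoef stat_sym// (lc_sym Dg_lc _ _ dx). Qed.

(** The form C(u,v,w) = g(K(u,v), w) is symmetric in u, v because both
    connections are torsion-free.  Since Dg is metric, (nabla_u g)(v,w) is
    - C(u,v,w) - C(u,w,v); its symmetry in u and v, which is the statistical
    condition, gives C(u,w,v) = C(v,w,u). *)
Lemma K_cubic i x u v w : dom i x ->
  ip g i x (Kcoef i x u v) w = ip g i x (Kcoef i x u w) v.
Proof.
move=> dx.
have Q a b c : dip g i a x b c =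
    ip g i x (D i x a b) c + ip g i x b (D i x a c)
    - ip g i x (Kcoef i x a b) c - ip g i x (Kcoef i x a c) b.
  rewrite (lc_metric Dg_lc)// /Kcoef !ipBl// !(ipC g i x _ b); lra.
have S a b c : ip g i x (Kcoef i x a c) b = ip g i x (Kcoef i x b c) a.
  case: gD => _ cD.
  have := cD i _ _ _ (smooth_cst i a) (smooth_cst i b) (smooth_cst i c) x dx.
  rewrite !nabla_metric_cst !Q (K_sym b a dx) (stat_sym b a dx); lra.
by rewrite (K_sym u v dx) S (K_sym w u dx).
Qed.

Lemma stat_metric i x u v w : dom i x ->
  dip g i u x v w = ip g i x (D i x u v) w + ip g i x (D i x u w) v
    - 2 * ip g i x (Kcoef i x u v) w.
Proof.
move=> dx; have := K_cubic u w v dx.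
rewrite (lc_metric Dg_lc)// (ipC g i x v) /Kcoef !ipBl//; lra.
Qed.

End Statistical.

Section SasakiMetric.
Context {R : realType} {n : nat} {M : manifold R n}.
Variables (g : metric M) (D : connection M) (gt : metric (tangent_bundle M)).
Hypothesis (gtS : sasakian g D gt).
Implicit Types (i : chart M).

(** The base vector whose vertical lift is the vertical part of a. *)
Definition vert i (z a : 'rV[R]_(n + n)) : 'rV[R]_n :=
  rsubmx a + D i (lsubmx z) (lsubmx a) (rsubmx z).

(** Every tangent vector of TM splits into the lifts of its two components, and
    each lift exists as an actual velocity. *)
Lemma sasakianE i (z a b : 'rV[R]_(n + n)) : dom i (lsubmx z) ->
  @ip _ _ (tangent_bundle M) gt i z a b =
  ip g i (lsubmx z) (lsubmx a) (lsubmx b) +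
  ip g i (lsubmx z) (vert i z a) (vert i z b).
Proof.
move=> dx; pose x := lsubmx z; pose xi := rsubmx z.
pose h u : 'rV[R]_(n + n) := row_mx u (- D i x u xi).
pose v w : 'rV[R]_(n + n) := row_mx 0 w.
have split_hv c : c = h (lsubmx c) + v (vert i z c).
  by rewrite /h /v add_row_mx addr0 /vert [rsubmx c + _]addrC addKr hsubmxK.
have dz : @dom _ _ (tangent_bundle M) i z by [].
have hl u := @horizontal_lift_exists _ _ M D i x xi u dx.
have vl w := @vertical_lift_exists _ _ M i x xi w dx.
have zE : row_mx x xi = z by rewrite hsubmxK.
have E u w : [/\ @ip _ _ (tangent_bundle M) gt i z (v u) (v w) = ip g i x u w,
    @ip _ _ (tangent_bundle M) gt i z (h u) (h w) = ip g i x u w &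
    @ip _ _ (tangent_bundle M) gt i z (v u) (h w) = 0].
  have [H1 _ _] := @gtS (cvec i x xi) (cvec i x u) (cvec i x w)
    (@cvec _ _ (tangent_bundle M) i z (v u)) (@cvec _ _ (tangent_bundle M) i z (v w))
    erefl erefl.
  have [_ H2' _] := @gtS (cvec i x xi) (cvec i x u) (cvec i x w)
    (@cvec _ _ (tangent_bundle M) i z (h u)) (@cvec _ _ (tangent_bundle M) i z (h w))
    erefl erefl.
  have [_ _ H3'] := @gtS (cvec i x xi) (cvec i x u) (cvec i x w)
    (@cvec _ _ (tangent_bundle M) i z (v u)) (@cvec _ _ (tangent_bundle M) i z (h w))
    erefl erefl.
  by rewrite -zE in H1 H2' H3' *; split; [exact: H1|exact: H2'|exact: H3'].
rewrite [in LHS](split_hv a) [in LHS](split_hv b).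
rewrite [LHS]ipDl// ![in LHS]ipDr// (ipC gt i z (h (lsubmx a)) (v _)).
have [-> _ _] := E (vert i z a) (vert i z b).
have [_ -> _] := E (lsubmx a) (lsubmx b).
have [_ _ ->] := E (vert i z b) (lsubmx a).
by have [_ _ ->] := E (vert i z a) (lsubmx b); rewrite addr0 add0r.
Qed.

End SasakiMetric.

(** * First derivatives of the Sasakian metric *)

Section Dip.
Context {R : realType} {n : nat} {M : manifold R n}.
Variables (g : metric M) (D : connection M).
Implicit Types (i : chart M).

Lemma dip_linearl i u x w : dom i x -> linear (fun v => dip g i u x v w).
Proof.
move=> dx a v v'; have dv c := derives_ip g u c w dx.
have : derives (fun y => a *: ip g i y v w + ip g i y v' w) x u
    (0 *: ip g i x v w + a *: dip g i u x v w + dip g i u x v' w).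
  by apply: derivesD => //; apply: derivesZ => //; exact: derives_cst.
rewrite scale0r add0r => -[_ H]; apply: etrans H; apply: near_eq_derive.
by apply: filterS (near_dom dx) => y dy; rewrite ip_linearl.
Qed.

Lemma dip_linearr i u x w : dom i x -> linear (fun v => dip g i u x w v).
Proof. by move=> dx a v v'; rewrite dipC dip_linearl// !(dipC g i u x w). Qed.

Lemma dip0l i u x w : dom i x -> dip g i u x 0 w = 0.
Proof. by move=> dx; exact: (linear0E (dip_linearl u w dx)). Qed.

Lemma dip0r i u x w : dom i x -> dip g i u x w 0 = 0.
Proof. by move=> dx; rewrite dipC dip0l. Qed.

Lemma dip_dir0 i x v w : dip g i 0 x v w = 0.
Proof. exact: derive0. Qed.

Lemma dchr_dir0 i x v w : dchr D i 0 x v w = 0.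
Proof. exact: derive0. Qed.

Lemma dchr_linearr i u x w : dom i x -> linear (fun v => dchr D i u x w v).
Proof.
move=> dx a v v'; have dv c := derives_christoffel D u w c dx.
have : derives (fun y => a *: D i y w v + D i y w v') x u
    (0 *: D i x w v + a *: dchr D i u x w v + dchr D i u x w v').
  by apply: derivesD => //; apply: derivesZ => //; exact: derives_cst.
rewrite scale0r add0r => -[_ H]; apply: etrans H; apply: near_eq_derive.
by apply: filterS (near_dom dx) => y dy; rewrite christoffel_linearr.
Qed.

Lemma dchr_linearl i u x w : dom i x -> linear (fun v => dchr D i u x v w).
Proof.
move=> dx a v v'; have dv c := derives_christoffel D u c w dx.
have : derives (fun y => a *: D i y v w + D i y v' w) x u
    (0 *: D i x v w + a *: dchr D i u x v w + dchr D i u x v' w).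
  by apply: derivesD => //; apply: derivesZ => //; exact: derives_cst.
rewrite scale0r add0r => -[_ H]; apply: etrans H; apply: near_eq_derive.
by apply: filterS (near_dom dx) => y dy; rewrite christoffel_linearl.
Qed.

Lemma dchr0l i u x w : dom i x -> dchr D i u x 0 w = 0.
Proof. by move=> dx; exact: (linear0E (dchr_linearl u w dx)). Qed.

Lemma differentiable_dip i u x v w : dom i x ->
  differentiable (fun y => dip g i u y v w) x.
Proof.
by move=> dx; have [_ /(_ u) [+ _]] := ip_smooth g i v w 2; exact.
Qed.

Lemma differentiable_dchr i u x v w : dom i x ->
  differentiable (fun y => dchr D i u y v w) x.
Proof.
by move=> dx; have [_ /(_ u) [+ _]] := @christoffel_smooth _ _ _ D i v w 2; exact.
Qed.

Lemma derives_dip_fields i c (V : normedModType R) (L : V -> 'rV[R]_n)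
    (f h : V -> 'rV[R]_n) z v dL df dh : dom i (L z) ->
  derives L z v dL -> derives f z v df -> derives h z v dh ->
  derives (fun y => dip g i c (L y) (f y) (h y)) z v
    ('D_dL (fun x => dip g i c x (f z) (h z)) (L z) + dip g i c (L z) df (h z)
     + dip g i c (L z) (f z) dh).
Proof.
move=> dz LdL fdf hdh.
have nL : \forall y \near z, dom i (L y).
  have [dLz _] := LdL; apply: (differentiable_continuous dLz).
  exact: near_dom.
apply: (@derives_bilinear_family _ _ _ _ _ (fun y => dip g i c (L y)) f h z v
  (fun u w => 'D_dL (fun x => dip g i c x u w) (L z)) df dh _ _ _ fdf hdh).
- by apply: filterS nL => y dy w; exact: dip_linearl.
- by apply: filterS nL => y dy w; exact: dip_linearr.
- move=> u w.
  apply: (derives_comp (f := fun y => dip g i c y u w) LdL).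
  exact: differentiable_dip.
Qed.

Lemma derives_dchr_fields i c b (V : normedModType R) (L : V -> 'rV[R]_n)
    (h : V -> 'rV[R]_n) z v dL dh : dom i (L z) ->
  derives L z v dL -> derives h z v dh ->
  derives (fun y => dchr D i c (L y) b (h y)) z v
    ('D_dL (fun x => dchr D i c x b (h z)) (L z) + dchr D i c (L z) b dh).
Proof.
move=> dz LdL hdh.
have nL : \forall y \near z, dom i (L y).
  have [dLz _] := LdL; apply: (differentiable_continuous dLz).
  exact: near_dom.
apply: (@derives_linear_family _ _ _ _ (fun y => dchr D i c (L y) b) h z v
  (fun w => 'D_dL (fun x => dchr D i c x b w) (L z)) dh _ _ hdh).
- by apply: filterS nL => y dy; exact: dchr_linearr.
- move=> w.
  apply: (derives_comp (f := fun y => dchr D i c y b w) LdL).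
  exact: differentiable_dchr.
Qed.
End Dip.

Section Components.
Context {R : realType} {n : nat} {M : manifold R n}.
Variables (g : metric M) (D : connection M) (gt : metric (tangent_bundle M)).
Hypothesis gtS : sasakian g D gt.
Variable i : chart M.
Local Notation ti := (i : chart (tangent_bundle M)).
Local Notation "'lx' z" := (lsubmx z : 'rV[R]_n) (at level 10, z at level 9).
Local Notation "'rx' z" := (rsubmx z : 'rV[R]_n) (at level 10, z at level 9).

Lemma derives_lsubmx (z v : 'rV[R]_(n + n)) :
  derives (fun y : 'rV[R]_(n + n) => lx y) z v (lx v).
Proof.
pose L : {linear 'rV[R]_(n + n) -> 'rV[R]_n} := lsubmx.
by apply: (@derives_linear _ _ _ _ L id); [exact: continuous_lsubmx|exact: derives_id].
Qed.

Lemma derives_rsubmx (z v : 'rV[R]_(n + n)) :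
  derives (fun y : 'rV[R]_(n + n) => rx y) z v (rx v).
Proof.
pose L : {linear 'rV[R]_(n + n) -> 'rV[R]_n} := rsubmx.
by apply: (@derives_linear _ _ _ _ L id); [exact: continuous_rsubmx|exact: derives_id].
Qed.

(** The derivative of vert z a in z along c. *)
Definition dvert (c z a : 'rV[R]_(n + n)) : 'rV[R]_n :=
  dchr D i (lx c) (lx z) (lx a) (rx z) + D i (lx z) (lx a) (rx c).

Lemma derives_vert z c a : dom i (lx z) ->
  derives (fun y => vert D i y a) z c (dvert c z a).
Proof.
move=> dz; rewrite -[dvert c z a]add0r; apply: derivesD; first exact: derives_cst.
have := derives_christoffel_fields D dz (derives_lsubmx z c)
  (derives_cst (lx a) z c) (derives_rsubmx z c).
by rewrite christoffel0l// addr0.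
Qed.

Lemma dsasaki z c a b : dom i (lx z) ->
  dip gt ti c z a b = dip g i (lx c) (lx z) (lx a) (lx b)
    + dip g i (lx c) (lx z) (vert D i z a) (vert D i z b)
    + ip g i (lx z) (dvert c z a) (vert D i z b)
    + ip g i (lx z) (vert D i z a) (dvert c z b).
Proof.
move=> dz.
have h1 := derives_ip_fields g dz (derives_lsubmx z c)
  (derives_cst (lx a) z c) (derives_cst (lx b) z c).
have h2 := derives_ip_fields g dz (derives_lsubmx z c)
  (derives_vert c a dz) (derives_vert c b dz).
have [_ H] := derivesD h1 h2.
rewrite ip0l// ip0r// !addr0 !addrA in H; rewrite -H.
apply: near_eq_derive; apply: filterS (near_dom (dz : dom ti z)) => y dy.
exact: sasakianE.
Qed.

End Components.

(** * The connection of the Sasakian metric on lifts *)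

Section Frame.
Context {R : realType} {n : nat} {M : manifold R n}.
Variables (g : metric M) (D Dg : connection M).
Variables (gt : metric (tangent_bundle M)) (Dgt : connection (tangent_bundle M)).
Hypotheses (gD : statistical g D) (Dg_lc : levi_civita g Dg).
Hypotheses (gtS : sasakian g D gt) (Dgt_lc : levi_civita gt Dgt).
Variables (i : chart M) (x xi : 'rV[R]_n).
Hypothesis dx : dom i x.
Local Notation ti := (i : chart (tangent_bundle M)).
Local Notation "'lx' z" := (lsubmx z : 'rV[R]_n) (at level 10, z at level 9).
Local Notation K := (Kcoef D Dg i x).
Local Notation "<[ u , v ]>" := (ip g i x u v).

(** The coordinates of the horizontal and of the vertical lift of a vector to
    the point (x, xi), used as constant fields. *)
Definition hvec u : 'rV[R]_(n + n) := row_mx u (- D i x u xi).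
Definition vvec w : 'rV[R]_(n + n) := row_mx 0 w.
Definition pt : 'rV[R]_(n + n) := row_mx x xi.

(** The value at pt of the derivative of vert z (hvec b) along hvec c. *)
Definition dvert_h c b := dchr D i c x b xi - D i x b (D i x c xi).

Let dpt : dom i (lx pt). Proof. by rewrite row_mxKl. Qed.

Lemma vert_hvec u : vert D i pt (hvec u) = 0.
Proof. by rewrite /vert !row_mxKl !row_mxKr addNr. Qed.

Lemma vert_vvec z w : dom i (lx z) -> vert D i z (vvec w) = w.
Proof. by move=> dz; rewrite /vert row_mxKl row_mxKr christoffel0l// addr0. Qed.

Lemma dvert_vvec c z w : dom i (lx z) -> dvert D i c z (vvec w) = 0.
Proof. by move=> dz; rewrite /dvert row_mxKl dchr0l// christoffel0l// addr0. Qed.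

Lemma dvert_vvec_dir c z b : dvert D i (vvec c) z b = D i (lx z) (lx b) c.
Proof. by rewrite /dvert row_mxKl row_mxKr dchr_dir0 add0r. Qed.

Lemma dvert_hvec c b : dvert D i (hvec c) pt (hvec b) = dvert_h c b.
Proof. by rewrite /dvert !row_mxKl !row_mxKr christoffelNr. Qed.

(** This is where the curvature of D enters: it measures the failure of the
    horizontal distribution to be integrable. *)
Lemma dvert_h_curvature a b :
  dvert_h a b - dvert_h b a = curvature_field D i (cst a) (cst b) (cst xi) x.
Proof.
rewrite curvature_field_cst// /dvert_h !opprD !opprK.
by rewrite addrACA [- D i x b _ + _]addrC addrACA.
Qed.

(** A name of the form dipABC records the types, V for vertical and H for
    horizontal, of the direction of differentiation and of the two
    arguments. *)
Lemma dipVVV z a b c : dom i (lx z) ->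
  dip gt ti (vvec a) z (vvec b) (vvec c) = 0.
Proof.
move=> dz; rewrite (dsasaki gtS)// !dvert_vvec// ip0l// ip0r//.
by rewrite !row_mxKl !dip_dir0 !addr0.
Qed.

Lemma dipHVV z a b c : dom i (lx z) ->
  dip gt ti (hvec a) z (vvec b) (vvec c) = dip g i a (lx z) b c.
Proof.
move=> dz; rewrite (dsasaki gtS)// !dvert_vvec// ip0l// ip0r// !vert_vvec//.
by rewrite !row_mxKl dip0l// add0r !addr0.
Qed.

Lemma dipVVH a b c :
  dip gt ti (vvec a) pt (vvec b) (hvec c) = <[b, D i x c a]>.
Proof.
rewrite (dsasaki gtS)// !dvert_vvec// vert_vvec// vert_hvec dvert_vvec_dir.
by rewrite ip0l// !row_mxKl !dip_dir0 !add0r.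
Qed.

Lemma dipHVH a b c :
  dip gt ti (hvec a) pt (vvec b) (hvec c) = <[b, dvert_h a c]>.
Proof.
rewrite (dsasaki gtS)// !dvert_vvec// vert_vvec// vert_hvec dvert_hvec.
by rewrite ip0l// !row_mxKl dip0l// dip0r// !add0r.
Qed.

Lemma dipVHH a b c : dip gt ti (vvec a) pt (hvec b) (hvec c) = 0.
Proof.
rewrite (dsasaki gtS)// !vert_hvec ip0l// ip0r// !row_mxKl !dip_dir0.
by rewrite !addr0.
Qed.

Lemma dipHHH a b c : dip gt ti (hvec a) pt (hvec b) (hvec c) = dip g i a x b c.
Proof.
rewrite (dsasaki gtS)// !vert_hvec ip0l// ip0r// !row_mxKl.
by rewrite (dip0l g)// !addr0.
Qed.

Lemma ip_split a b :
  @ip _ _ (tangent_bundle M) gt i pt a b =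
  <[lx a, lx b]> + <[vert D i pt a, vert D i pt b]>.
Proof. by rewrite (sasakianE gtS)// row_mxKl. Qed.

Lemma ip_hvec a u : @ip _ _ (tangent_bundle M) gt i pt a (hvec u) = <[lx a, u]>.
Proof. by rewrite ip_split vert_hvec ip0r// row_mxKl addr0. Qed.

Lemma ip_vvec a w :
  @ip _ _ (tangent_bundle M) gt i pt a (vvec w) = <[vert D i pt a, w]>.
Proof. by rewrite ip_split vert_vvec// row_mxKl ip0r// add0r. Qed.

Lemma lift_components A l v :
  (forall c, @ip _ _ (tangent_bundle M) gt i pt A (hvec c) = <[l, c]>) ->
  (forall c, @ip _ _ (tangent_bundle M) gt i pt A (vvec c) = <[v, c]>) ->
  lx A = l /\ vert D i pt A = v.
Proof.
move=> hA vA; split; apply: (ip_inj (g := g) dx) => c.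
  by rewrite -ip_hvec.
by rewrite -ip_vvec.
Qed.

Local Notation G := (Dgt ti pt).

(** The horizontal part comes from (nabla_c g)(a,b) = - 2 g(K(a,b), c). *)
Lemma nabla_vv a b : lx (G (vvec a) (vvec b)) = K a b /\
  vert D i pt (G (vvec a) (vvec b)) = 0.
Proof.
apply: lift_components => c; rewrite (koszul Dgt_lc)//.
  rewrite !dipVVH dipHVV// row_mxKl (stat_metric gD Dg_lc)//.
  rewrite (ipC g i x b) (ipC g i x a) (K_sym gD Dg_lc c a)//.
  by rewrite (K_cubic gD Dg_lc a c b)//; lra.
by rewrite !dipVVV// ip0l//; lra.
Qed.

Lemma nabla_hh a b : lx (G (hvec a) (hvec b)) = Dg i x a b /\
  vert D i pt (G (hvec a) (hvec b)) = 2^-1 *: (dvert_h a b + dvert_h b a).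
Proof.
apply: lift_components => c; rewrite (koszul Dgt_lc)//.
  by rewrite !dipHHH (koszul Dg_lc).
rewrite (dipC gt ti (hvec a)) (dipC gt ti (hvec b)) !dipHVH dipVHH.
by rewrite ipZl// ipDl// !(ipC g i x c); lra.
Qed.

(** The vector r is - R_1(b, xi, a); this is how the existence of R_1 is
    obtained. *)
Lemma nabla_vh a b : exists r,
  [/\ forall c, <[r, c]> =
        2^-1 * <[a, curvature_field D i (cst b) (cst c) (cst xi) x]>,
      lx (G (vvec a) (hvec b)) = r &
      vert D i pt (G (vvec a) (hvec b)) = Dg i x b a].
Proof.
have E c : <[lx (G (vvec a) (hvec b)), c]> =
    2^-1 * <[a, curvature_field D i (cst b) (cst c) (cst xi) x]>.
  rewrite -ip_hvec (koszul Dgt_lc)// dipVHH !dipHVH.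
  by rewrite -dvert_h_curvature (ipBr g dx (dvert_h b c)); lra.
exists (lx (G (vvec a) (hvec b))); split=> //.
apply: (ip_inj (g := g) dx) => c; rewrite -ip_vvec (koszul Dgt_lc)//.
rewrite (dipC gt ti (vvec a) _ (hvec b)) dipHVV// row_mxKl !dipVVH.
rewrite (stat_metric gD Dg_lc)// /Kcoef !ipBl// !(ipC g i x c) (ipC g i x a).
lra.
Qed.

End Frame.

(** * Curvature on vertical and on horizontal planes *)

Section Curvatures.
Context {R : realType} {n : nat} {M : manifold R n}.
Variables (g : metric M) (D Dg : connection M).
Variables (gt : metric (tangent_bundle M)) (Dgt : connection (tangent_bundle M)).
Hypotheses (gD : statistical g D) (Dg_lc : levi_civita g Dg).
Hypotheses (gtS : sasakian g D gt) (Dgt_lc : levi_civita gt Dgt).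
Variables (i : chart M) (x xi : 'rV[R]_n).
Hypothesis dx : dom i x.
Local Notation ti := (i : chart (tangent_bundle M)).
Local Notation "'lx' z" := (lsubmx z : 'rV[R]_n) (at level 10, z at level 9).
Local Notation "'rx' z" := (rsubmx z : 'rV[R]_n) (at level 10, z at level 9).
Local Notation K := (Kcoef D Dg i x).
Local Notation "<[ u , v ]>" := (ip g i x u v).
Local Notation H := (hvec D i x xi).
Local Notation V := vvec.
Local Notation p0 := (pt x xi).
Local Notation P := (dvert_h D i x xi).
Local Notation curv a b c := (curvature_field Dgt ti (cst a) (cst b) (cst c) p0).
Local Notation ipt := (@ip _ _ (tangent_bundle M) gt i p0).

Let dpt : dom i (lx p0). Proof. by rewrite row_mxKl. Qed.

Let near_pt : \forall z \near p0, dom i (lx z).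
Proof. exact: (near_dom (dpt : dom ti p0)). Qed.

Lemma derives_dvert z a c b : dom i (lx z) ->
  derives (fun y => dvert D i c y b) z a
    ('D_(lx a) (fun x => dchr D i (lx c) x (lx b) (rx z)) (lx z)
     + dchr D i (lx c) (lx z) (lx b) (rx a)
     + dchr D i (lx a) (lx z) (lx b) (rx c)).
Proof.
move=> dz; apply: derivesD.
  exact: (derives_dchr_fields D (lx c) (lx b) dz (derives_lsubmx z a)
    (derives_rsubmx z a)).
have := derives_christoffel_fields D dz (derives_lsubmx z a)
  (derives_cst (lx b) z a) (derives_cst (rx c) z a).
by rewrite (christoffel0l D (rx c) dz) (christoffel0r D (lx b) dz) !addr0.
Qed.

Lemma near_cst_derive (U W : normedModType R) (f : U -> W) y v c :
  (\forall z \near y, f z = c) -> 'D_v f y = 0.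
Proof. by move=> fc; rewrite (near_eq_derive _ fc) derive_cst. Qed.

Lemma ddipVVVV a b c d :
  'D_(V a) (fun z => dip gt ti (V b) z (V c) (V d)) p0 = 0.
Proof.
apply: (@near_cst_derive _ _ _ _ _ 0); apply: filterS near_pt => z dz.
exact: (dipVVV gtS).
Qed.

Lemma ddipHHVV a b c d :
  'D_(H a) (fun z => dip gt ti (H b) z (V c) (V d)) p0 =
  'D_a (fun y => dip g i b y c d) x.
Proof.
have E : \forall z \near p0,
    dip gt ti (H b) z (V c) (V d) = dip g i b (lx z) c d.
  by apply: filterS near_pt => z dz; exact: (dipHVV gtS x xi b c d dz).
rewrite (near_eq_derive _ E).
have [_ ->] := derives_comp (f := fun y => dip g i b y c d)
  (derives_lsubmx p0 (H a)) (differentiable_dip g b c d dpt).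
by rewrite !row_mxKl.
Qed.

(** The factors vert z (H c) and vert z (H d) vanish at the point, so only the
    terms in which both have been differentiated remain; the same happens in
    ddipHHHH. *)
Lemma ddipVVHH a b c d :
  'D_(V a) (fun z => dip gt ti (V b) z (H c) (H d)) p0 =
  <[D i x c b, D i x d a]> + <[D i x c a, D i x d b]>.
Proof.
have E : \forall z \near p0, ip g i (lx z) (D i (lx z) c b) (vert D i z (H d))
    + ip g i (lx z) (vert D i z (H c)) (D i (lx z) d b) =
    dip gt ti (V b) z (H c) (H d).
  apply: filterS near_pt => z dz; rewrite (dsasaki gtS)// !dvert_vvec_dir.
  by rewrite !row_mxKl !dip_dir0 !add0r.
rewrite -(near_eq_derive _ E).
have dD u := derives_christoffel_fields D dpt (derives_lsubmx p0 (V a))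
  (derives_cst u p0 (V a)) (derives_cst b p0 (V a)).
have dv u := derives_vert D (V a) (H u) dpt.
have [_ ->] := derivesD
  (derives_ip_fields g dpt (derives_lsubmx p0 (V a)) (dD c) (dv d))
  (derives_ip_fields g dpt (derives_lsubmx p0 (V a)) (dv c) (dD d)).
rewrite !vert_hvec// !dvert_vvec_dir !row_mxKl !dip_dir0 !dchr_dir0.
by rewrite (ip0l g dx) (ip0r g dx) !add0r addr0.
Qed.

Lemma ddipVHVH a b c d :
  'D_(V a) (fun z => dip gt ti (H b) z (V c) (H d)) p0 =
  dip g i b x c (D i x d a) + <[c, dchr D i b x d a]>.
Proof.
have E : \forall z \near p0, dip g i b (lx z) c (vert D i z (H d))
    + ip g i (lx z) c (dvert D i (H b) z (H d)) =
    dip gt ti (H b) z (V c) (H d).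
  apply: filterS near_pt => z dz; rewrite (dsasaki gtS)// dvert_vvec//.
  by rewrite vert_vvec// ip0l// !row_mxKl dip0l// add0r addr0.
rewrite -(near_eq_derive _ E).
have dc := derives_cst c p0 (V a).
have [_ ->] := derivesD
  (derives_dip_fields g b dpt (derives_lsubmx p0 (V a)) dc
    (derives_vert D (V a) (H d) dpt))
  (derives_ip_fields g dpt (derives_lsubmx p0 (V a)) dc
    (derives_dvert (V a) (H b) (H d) dpt)).
rewrite !vert_hvec// !dvert_vvec_dir !row_mxKl !row_mxKr !dip_dir0 !dchr_dir0.
by rewrite !derive0 dip0l// ip0l// !add0r !addr0.
Qed.

Lemma ddipHHHH a b c d :
  'D_(H a) (fun z => dip gt ti (H b) z (H c) (H d)) p0 =
  'D_a (fun y => dip g i b y c d) x + <[P b c, P a d]> + <[P a c, P b d]>.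
Proof.
have E : \forall z \near p0, dip g i b (lx z) c d
    + dip g i b (lx z) (vert D i z (H c)) (vert D i z (H d))
    + ip g i (lx z) (dvert D i (H b) z (H c)) (vert D i z (H d))
    + ip g i (lx z) (vert D i z (H c)) (dvert D i (H b) z (H d)) =
    dip gt ti (H b) z (H c) (H d).
  apply: filterS near_pt => z dz.
  by have -> := dsasaki gtS (H b) (H c) (H d) dz; rewrite !row_mxKl.
rewrite -(near_eq_derive _ E).
have dl := derives_lsubmx p0 (H a).
have dv u := derives_vert D (H a) (H u) dpt.
have dd u := derives_dvert (H a) (H b) (H u) dpt.
have [_ ->] := derivesD (derivesD (derivesD
  (derives_comp (f := fun y => dip g i b y c d) dl
     (differentiable_dip g b c d dpt))
  (derives_dip_fields g b dpt dl (dv c) (dv d)))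
  (derives_ip_fields g dpt dl (dd c) (dv d)))
  (derives_ip_fields g dpt dl (dv c) (dd d)).
rewrite !vert_hvec// !dvert_hvec//.
rewrite (@near_cst_derive _ _ (fun y => dip g i b y 0 0) _ _ 0); last first.
  by apply: filterS (near_dom dpt) => y dy; rewrite dip0l.
by rewrite !row_mxKl !dip0l// !dip0r// !ip0l// !ip0r// !add0r !addr0.
Qed.

Lemma curvature_vv a b :
  ipt (curv (V a) (V b) (V b)) (V a) = <[K a b, K a b]> - <[K a a, K b b]>.
Proof.
rewrite (lc_curvature Dgt_lc)// !ddipVVVV !(ip_split gtS xi dx).
have N u v := nabla_vv gD Dg_lc gtS Dgt_lc xi dx u v.
have [-> ->] := N a b; have [-> ->] := N a a; have [-> ->] := N b b.
by rewrite !ip0l//; lra.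
Qed.

(** The terms in P are
      <P(b,a), P(a,b)> + <P(a,a), P(b,b)> - |P(a,b)|^2 - |P(b,a)|^2
    from the second derivatives, and |P(a,b) + P(b,a)|^2 / 4 - <P(a,a), P(b,b)>
    from the connection; the remaining terms are the curvature of g. *)
Lemma curvature_hh a b :
  ipt (curv (H a) (H b) (H b)) (H a) =
  <[curvature_field Dg i (cst a) (cst b) (cst b) x, a]> -
  3 / 4 * <[curvature_field D i (cst a) (cst b) (cst xi) x,
            curvature_field D i (cst a) (cst b) (cst xi) x]>.
Proof.
rewrite (lc_curvature Dgt_lc)// (lc_curvature Dg_lc)// !ddipHHHH.
rewrite !(ip_split gtS xi dx) -!dvert_h_curvature//.
have N u v := nabla_hh Dg_lc gtS Dgt_lc xi dx u v.
have [-> ->] := N a b; have [-> ->] := N a a; have [-> ->] := N b b.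
move: ('D_a (fun y => dip g i b y a b) x) ('D_a (fun y => dip g i a y b b) x)
  ('D_b (fun y => dip g i b y a a) x) => p q r.
move: (P a b) (P b a) (P a a) (P b b) => ab ba aa bb.
rewrite !ipZl// !ipZr// !ipDl// !ipDr// !ipNl// !ipNr// (ipC g i x ba ab).
lra.
Qed.

End Curvatures.

(** * Curvature on mixed planes *)

Section Mixed.
Context {R : realType} {n : nat} {M : manifold R n}.
Variables (g : metric M) (D Dg : connection M).
Variables (gt : metric (tangent_bundle M)) (Dgt : connection (tangent_bundle M)).
Hypotheses (gD : statistical g D) (Dg_lc : levi_civita g Dg).
Hypotheses (gtS : sasakian g D gt) (Dgt_lc : levi_civita gt Dgt).
Variables (i : chart M) (x xi : 'rV[R]_n).
Hypothesis dx : dom i x.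
Local Notation ti := (i : chart (tangent_bundle M)).
Local Notation K := (Kcoef D Dg i x).
Local Notation "<[ u , v ]>" := (ip g i x u v).
Local Notation H := (hvec D i x xi).
Local Notation V := vvec.
Local Notation p0 := (pt x xi).
Local Notation curv a b c := (curvature_field Dgt ti (cst a) (cst b) (cst c) p0).
Local Notation ipt := (@ip _ _ (tangent_bundle M) gt i p0).

Lemma dchr_sym (E : connection M) c a b : torsion_free E ->
  dchr E i c x a b = dchr E i c x b a.
Proof.
move=> tE; apply: near_eq_derive; apply: filterS (near_dom dx) => y dy.
exact: torsion_free_sym.
Qed.

Lemma nablaK_field_cst a b c :
  nablaK_field D Dg i (cst b) (cst a) (cst c) x =
  (dchr D i b x a c - dchr Dg i b x a c) + D i x b (K a c)
  - K (D i x b a) c - K a (D i x b c).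
Proof.
have KE : K_field D Dg i (cst a) (cst c) = fun y => D i y a c - Dg i y a c.
  by apply/funext => y; rewrite /K_field !nabla_cst.
have KN u v : nabla D i (cst u) (cst v) = fun y => D i y u v.
  by apply/funext => y; exact: nabla_cst.
rewrite /nablaK_field KE !KN; congr (_ + _ - _ - _).
- have [_ ->//] := derivesD (derives_christoffel D b a c dx)
    (derivesN (derives_christoffel Dg b a c dx)).
- by rewrite /K_field /nabla !derive_cst !add0r.
- by rewrite /K_field /nabla opprD addrACA subrr add0r.
Qed.

(** With D = Dg + K, the derivatives of Dg and of D occur only through their
    difference, the derivative of K; the quadratic terms are then matched with
    those of nabla K by the total symmetry of g(K(u,v), w). *)
Lemma curvature_vh a b : exists2 r,
  (forall c, <[r, c]> =
    2^-1 * <[a, curvature_field D i (cst b) (cst c) (cst xi) x]>) &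
  ipt (curv (V a) (H b) (H b)) (V a) =
    <[K a (K b b) - K b (K a b), a]>
    + <[nablaK_field D Dg i (cst b) (cst a) (cst b) x, a]> + <[r, r]>.
Proof.
have [r [rP lr vr]] := nabla_vh gD Dg_lc gtS Dgt_lc xi dx a b.
exists r => //.
rewrite (lc_curvature Dgt_lc)//; last by rewrite /= /tb_dom /= row_mxKl.
rewrite (ddipVHVH gtS)// (ddipVVHH gtS)// (ddipHHVV gtS)//.
rewrite !(ip_split gtS xi dx) lr vr.
have [-> ->] := nabla_vv gD Dg_lc gtS Dgt_lc xi dx a a.
have [-> _] := nabla_hh Dg_lc gtS Dgt_lc xi dx b b.
rewrite (ip0l g dx) addr0.
have -> : 'D_b (fun y => dip g i b y a a) x =
    2 * (dip g i b x (Dg i x b a) a + <[dchr Dg i b x b a, a]>).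
  have E : \forall y \near x,
      2 *: ip g i y (Dg i y b a) a = dip g i b y a a.
    apply: filterS (near_dom dx) => y dy; rewrite (lc_metric Dg_lc)//.
    by rewrite (ipC g i y a) -[LHS]/(2 * _) mulr2n mulrDl mul1r.
  rewrite -(near_eq_derive _ E).
  have [_ ->] := derivesZ (derives_cst (2 : R) x b)
    (derives_ip_fields g dx (derives_id x b)
       (derives_christoffel Dg b b a dx) (derives_cst a x b)).
  by rewrite (ip0r g dx) scale0r add0r addr0.
rewrite nablaK_field_cst.
have tD : torsion_free D by case: gD.
have tDg : torsion_free Dg by case: Dg_lc.
rewrite (dchr_sym b a b tD) (dchr_sym b a b tDg).
have DE u v : D i x u v = Dg i x u v + K u v by rewrite /Kcoef addrC subrK.
rewrite !DE (K_sym gD Dg_lc b a dx).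
have cub u v w := K_cubic gD Dg_lc u v w dx.
have sym u v := K_sym gD Dg_lc u v dx.
have C1 u : <[K u b, a]> = <[K a b, u]> by rewrite sym cub sym.
have C2 u : <[K a u, a]> = <[K a a, u]> by rewrite cub.
move: (Kcoef D Dg i x) {cub sym DE} C1 C2 => k C1 C2.
rewrite !ipBl// !ipDl// !C1 !C2.
have -> : dip g i b x a (Dg i x b a + k a b) =
   dip g i b x (Dg i x b a) a + <[Dg i x b a, k a b]> + <[Dg i x b (k a b), a]>.
  have := dip_linearr g b a dx 1 (Dg i x b a) (k a b); rewrite !scale1r => ->.
  rewrite (lc_metric Dg_lc _ _ (k a b))// (ipC g i x a (Dg i x b (k a b))) addrA.
  by rewrite (dipC g i b x a).
rewrite !ipDr// (ipNl g dx) (ipC g i x a) (ipC g i x (k a b) (Dg i x b a)).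
move: (dip g i b x (Dg i x b a) a) => t; lra.
Qed.

End Mixed.

(** * From coordinates to tangent vectors *)

Section Tensors.
Context {R : realType} {n : nat} {M : manifold R n}.
Implicit Types (g : metric M) (D Dg : connection M) (i : chart M).

Lemma ipE g i x u v : g (cvec i x u) (cvec i x v) = ip g i x u v.
Proof. by []. Qed.

Lemma crd_cvec i x u : dom i x -> crd i (foot (cvec i x u)) = x.
Proof. exact: parK. Qed.

Lemma curvature_cvec D i x a b c : dom i x ->
  curvature D i (cvec i x a) (cvec i x b) (cvec i x c) =
  cvec i x (curvature_field D i (cst a) (cst b) (cst c) x).
Proof. by move=> dx; rewrite /curvature crd_cvec// !tcrd_cvec. Qed.

Lemma sectional_cvec g Dg i x a b : dom i x ->
  sectional g Dg i (cvec i x a) (cvec i x b) =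
  ip g i x (curvature_field Dg i (cst a) (cst b) (cst b) x) a /
    (ip g i x a a * ip g i x b b - ip g i x a b ^+ 2).
Proof. by move=> dx; rewrite /sectional curvature_cvec. Qed.

Lemma K_bracket_cvec D Dg i x a b c : dom i x ->
  K_bracket D Dg i (cvec i x a) (cvec i x b) (cvec i x c) =
  cvec i x (Kcoef D Dg i x a (Kcoef D Dg i x b c)
            - Kcoef D Dg i x b (Kcoef D Dg i x a c)).
Proof.
move=> dx; have KE u v : K_tensor D Dg i (cvec i x u) (cvec i x v) =
    cvec i x (Kcoef D Dg i x u v).
  by rewrite /K_tensor crd_cvec// !tcrd_cvec// /K_field !nabla_cst.
by rewrite /K_bracket !KE crd_cvec// !tcrd_cvec.
Qed.

Lemma nablaK_cvec D Dg i x a b c : dom i x ->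
  nablaK D Dg i (cvec i x a) (cvec i x b) (cvec i x c) =
  cvec i x (nablaK_field D Dg i (cst a) (cst b) (cst c) x).
Proof. by move=> dx; rewrite /nablaK crd_cvec// !tcrd_cvec. Qed.

Lemma curvature_antisym D i x a b c : dom i x ->
  curvature_field D i (cst a) (cst b) (cst c) x =
  - curvature_field D i (cst b) (cst a) (cst c) x.
Proof. by move=> dx; rewrite !curvature_field_cst// opprB. Qed.

(** The coordinate expressions cancel in pairs, by the symmetry of the
    Christoffel symbols and of their derivatives. *)
Lemma bianchi D i x a b c : dom i x -> torsion_free D ->
  curvature_field D i (cst a) (cst b) (cst c) x
  + curvature_field D i (cst b) (cst c) (cst a) x
  + curvature_field D i (cst c) (cst a) (cst b) x = 0.
Proof.
move=> dx tD; rewrite !curvature_field_cst//.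
rewrite (dchr_sym dx a b c)// (dchr_sym dx b c a)// (dchr_sym dx c a b)//.
rewrite (torsion_free_sym b c tD)// (torsion_free_sym c a tD)//.
rewrite (torsion_free_sym a b tD)//.
by rewrite !subrKA subrr.
Qed.

(** The set that defines R_1 contains - r by the antisymmetry of the curvature,
    and no other vector by positivity of the metric. *)
Lemma R1_cvec g D i x a b xi r : dom i x ->
  (forall c, ip g i x r c =
     2^-1 * ip g i x a (curvature_field D i (cst b) (cst c) (cst xi) x)) ->
  R1 g D i (cvec i x b) (cvec i x xi) (cvec i x a) = cvec i x (- r).
Proof.
move=> dx rP; rewrite /R1 crd_cvec//; congr cvec.
set S := [set _ | _].
have SP s : S s <-> forall w, ip g i x w s =
    2^-1 * ip g i x (curvature_field D i (cst w) (cst b) (cst xi) x) a.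
  split=> [Ss w|h W fW].
    by rewrite -ipE Ss// curvature_cvec.
  have iW : in_chart i (foot W) by rewrite fW; exists x.
  have cW : crd i (foot W) = x by rewrite fW /= parK.
  by rewrite -(cvecK iW) cW curvature_cvec// !ipE.
have Sr : S (- r).
  apply/SP => w; rewrite ipNr// (ipC g i x w) rP curvature_antisym// ipNr//.
  by rewrite (ipC g i x a) mulrN opprK.
have /SP Sx : S (xget 0 S) by apply: xgetPex; exists (- r).
apply: (ip_inj (g := g) dx) => w; move/SP : Sr => Sr.
by rewrite !(ipC g i x _ w) Sx Sr.
Qed.

(** The curvature of D is antisymmetric in its first two arguments, satisfies
    the first Bianchi identity, and by conjugate symmetry is antisymmetric in
    the last two; a signed sum of the four Bianchi identities on a, b, xi, w
    gives its invariance under exchange of the two pairs. *)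
Lemma conjugate_symmetric_pair g D i x a b xi r : dom i x ->
  torsion_free D -> conjugate_symmetric g D ->
  (forall c, ip g i x r c =
     2^-1 * ip g i x a (curvature_field D i (cst b) (cst c) (cst xi) x)) ->
  - r = 2^-1 *: curvature_field D i (cst a) (cst xi) (cst b) x.
Proof.
move=> dx tD cs rP.
pose T a b c d := ip g i x (curvature_field D i (cst a) (cst b) (cst c) x) d.
have T12 p q s t : T p q s t = - T q p s t.
  by rewrite /T curvature_antisym// ipNl.
have T34 p q s t : T p q s t = - T p q t s.
  have px : in_chart i (par i x) by exists x.
  have := cs i (cvec i x p) (cvec i x q) (cvec i x s) (cvec i x t) px
    erefl erefl erefl.
  by rewrite !curvature_cvec// !ipE.
have B p q s t : T p q s t + T q s p t + T s p q t = 0.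
  by rewrite /T -!ipDl// bianchi// ip0l.
apply: (ip_inj (g := g) dx) => w.
rewrite ipNl// rP ipZl// (ipC g i x a) -/(T b w xi a) -/(T a xi b w).
suff -> : T a xi b w = - T b w xi a by lra.
move: (B a xi b w) (B xi b w a) (B b w a xi) (B w a xi b).
move: (T12 w xi b a) (T12 w a b xi) (T12 w a xi b) (T12 b a xi w).
move: (T34 xi b w a) (T34 b w xi a) (T34 xi w b a) (T34 a w b xi).
move: (T34 a b w xi) (T34 a xi w b).
move: T {B T12 T34} => T; lra.
Qed.

End Tensors.

Theorem proposition2p13 (R : realType) (n : nat) (M : manifold R n)
    (M_hausdorff : mhausdorff M) (M_countable : msecond_countable M)
    (g : metric M) (D : connection M) (gD : statistical g D)
    (Dg : connection M) (Dg_lc : levi_civita g Dg)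
    (gt : metric (tangent_bundle M)) (gt_sasakian : sasakian g D gt)
    (Dgt : connection (tangent_bundle M)) (Dgt_lc : levi_civita gt Dgt)
    (xi X Y : tangent M) (footX : foot X = foot xi) (footY : foot Y = foot xi)
    (unitX : g X X = 1) (unitY : g Y Y = 1)
    (i : chart M) (xi_i : in_chart i (foot xi))
    (Xv Yv Xh Yh : tangent (tangent_bundle M))
    (XvP : vertical_lift xi X Xv) (YvP : vertical_lift xi Y Yv)
    (XhP : horizontal_lift D xi X Xh) (YhP : horizontal_lift D xi Y Yh) :
  [/\ g X Y = 0 ->
        sectional gt Dgt i Xv Yv = - K_sectional g D Dg i X Y,
      g X Y = 0 ->
        sectional gt Dgt i Xh Yh =
        sectional g Dg i X Y
        - 3 / 4 * g (curvature D i X Y xi) (curvature D i X Y xi),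
      sectional gt Dgt i Xv Yh =
        g (K_bracket D Dg i X Y Y) X + g (nablaK D Dg i Y X Y) X
        + g (R1 g D i Y xi X) (R1 g D i Y xi X) &
      conjugate_symmetric g D ->
        sectional gt Dgt i Xv Yh =
        g (K_bracket D Dg i X Y Y) X + g (nablaK D Dg i Y X Y) X
        + 1 / 4 * g (curvature D i X xi Y) (curvature D i X xi Y)].
Proof.
set x := crd i (foot xi); have dx : dom i x by exact: dom_crd.
set u := tcrd xi i; set a := tcrd X i; set b := tcrd Y i.
have xiE : xi = cvec i x u by rewrite cvecK.
have XE : X = cvec i x a by rewrite /x -footX cvecK// footX.
have YE : Y = cvec i x b by rewrite /x -footY cvecK// footY.
pose p := pt x u.
have liftE (A : tangent (tangent_bundle M)) w : foot A = xi -> tcrd A i = w ->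
    A = @cvec _ _ (tangent_bundle M) i p w.
  move=> fA <-; have iA : @in_chart _ _ (tangent_bundle M) i (foot A).
    by apply/tb_in_chart; rewrite fA.
  rewrite -[LHS](cvecK iA); congr cvec.
  by rewrite fA.
have [fXv cXv] := vertical_liftE xi_i XvP.
have [fYv cYv] := vertical_liftE xi_i YvP.
have [fXh cXh] := horizontal_liftE xi_i XhP.
have [fYh cYh] := horizontal_liftE xi_i YhP.
have XvE : Xv = @cvec _ _ (tangent_bundle M) i p (vvec a) by exact: liftE.
have YvE : Yv = @cvec _ _ (tangent_bundle M) i p (vvec b) by exact: liftE.
have XhE : Xh = @cvec _ _ (tangent_bundle M) i p (hvec D i x u a).
  exact: liftE.
have YhE : Yh = @cvec _ _ (tangent_bundle M) i p (hvec D i x u b).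
  exact: liftE.
have dp : @dom _ _ (tangent_bundle M) i p by rewrite /= /tb_dom /= row_mxKl.
have dlp : dom i (lsubmx p) by rewrite row_mxKl.
have tD : torsion_free D by case: gD.
(* The coordinates become variables, so that xi, X, Y can be replaced by their
   expressions in them. *)
clearbody x u a b.
rewrite {}XvE {}YvE {}XhE {}YhE.
have S v w := @sectional_cvec _ _ (tangent_bundle M) gt Dgt i p v w dp.
have ipp := ip_split gt_sasakian u dx.
have vh w : vert D i p (hvec D i x u w) = 0 by exact: vert_hvec.
have vv w : vert D i p (vvec w) = w by exact: vert_vvec.
have lh w : lsubmx (hvec D i x u w) = w by rewrite row_mxKl.
have lv w : lsubmx (vvec w : 'rV[R]_(n + n)) = 0 by rewrite row_mxKl.
have aa : ip g i x a a = 1 by rewrite -ipE -XE.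
have bb : ip g i x b b = 1 by rewrite -ipE -YE.
have ab : g X Y = ip g i x a b by rewrite XE YE.
have Svv : g X Y = 0 -> sectional gt Dgt i
    (@cvec _ _ (tangent_bundle M) i p (vvec a))
    (@cvec _ _ (tangent_bundle M) i p (vvec b)) = - K_sectional g D Dg i X Y.
  rewrite ab S => ab0; rewrite (curvature_vv gD Dg_lc gt_sasakian Dgt_lc u dx).
  rewrite !ipp !vv !lv !(ip0l g dx) !add0r aa bb ab0 expr0n subr0 mulr1 divr1.
  rewrite /K_sectional XE YE K_bracket_cvec// ipE.
  rewrite (ipBl g dx (Kcoef D Dg i x a _) (Kcoef D Dg i x b _)).
  rewrite (K_cubic gD Dg_lc a _ a dx) (K_cubic gD Dg_lc b _ a dx).
  by rewrite (K_sym gD Dg_lc b a dx) opprB.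
have Shh : g X Y = 0 -> sectional gt Dgt i
    (@cvec _ _ (tangent_bundle M) i p (hvec D i x u a))
    (@cvec _ _ (tangent_bundle M) i p (hvec D i x u b)) =
    sectional g Dg i X Y
        - 3 / 4 * g (curvature D i X Y xi) (curvature D i X Y xi).
  rewrite ab S => ab0; rewrite (curvature_hh Dg_lc gt_sasakian Dgt_lc u dx).
  rewrite !ipp !vh !lh !(ip0l g dx) !addr0 XE YE xiE sectional_cvec//.
  by rewrite curvature_cvec// ipE aa bb ab0 expr0n subr0 mulr1 !divr1.
have Svh : exists2 r, (forall c, ip g i x r c =
     2^-1 * ip g i x a (curvature_field D i (cst b) (cst c) (cst u) x)) &
    sectional gt Dgt i
    (@cvec _ _ (tangent_bundle M) i p (vvec a))
    (@cvec _ _ (tangent_bundle M) i p (hvec D i x u b)) =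
    g (K_bracket D Dg i X Y Y) X + g (nablaK D Dg i Y X Y) X + ip g i x r r.
  have [r rP E] := curvature_vh gD Dg_lc gt_sasakian Dgt_lc u dx a b.
  exists r => //; rewrite S E XE YE K_bracket_cvec// nablaK_cvec// !ipE.
  rewrite !ipp !vv !vh !lv !lh !(ip0l g dx) !(ip0r g dx) !add0r !addr0 aa bb.
  by rewrite expr0n subr0 mulr1 divr1.
have [r rP Sr] := Svh.
split; [exact: Svv|exact: Shh| |move=> cs]; rewrite Sr; congr (_ + _).
  by rewrite XE YE xiE (R1_cvec dx rP) ipE ipNl// ipNr// opprK.
have rE := conjugate_symmetric_pair dx tD cs rP.
rewrite XE YE xiE curvature_cvec// ipE.
have -> : r = - (2^-1 *: curvature_field D i (cst a) (cst u) (cst b) x).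
  by rewrite -rE opprK.
by rewrite ipNl// ipNr// ipZl// ipZr//; lra.
Qed.
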